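(* Assume the regularity conditions (i) and (ii) of the context, and use the notation of the context. Then the density $f_t$ of the mean-field Langevin process satisfies, for $t\in(0,T)$, the GENERIC-form equation $$\partial_tf_t=\mathcal L(f_t)\frac{\delta H}{\delta f}(f_t)-\mathcal J(f_t)\frac{\delta\mathcal F}{\delta f}(f_t)=-\{f_t,h_{f_t}\}+\operatorname{div}\Big(\tfrac12GG^\top f_t\,\nabla\big(\ln f_t+\beta m\,h_{f_t}\big)\Big).$$
   Context: Fix $d\ge1$, $T\in(0,\infty)$ and positive constants $m,\gamma,\beta$; put $\sigma=\sqrt{2\gamma/(\beta m^2)}$. Points of $\mathbb{R}^{2d}=\mathbb{R}^d\times\mathbb{R}^d$ are written $z=(x,v)^\top$. $(B_t)_{t\ge0}$ is a standard $d$-dimensional Brownian motion on a probability space $(\Omega,\mathcal G,\mathbb P)$ with normal filtration, and $\mathbb E$ is expectation under $\mathbb P$. Regularity conditions. (i) $U,K:\mathbb{R}^d\to[0,\infty)$ are smooth, $K$ is symmetric ($K(-x)=K(x)$), $U(x)\ge\kappa_U|x|^2$ for all $x$ and some $\kappa_U>0$, $\nabla U$ and $\nabla K$ are Lipschitz, and for every $j\ge2$ there is a constant $C_j$ with $|\nabla^jU|\le C_j$, $|\nabla^jK|\le C_j$. (ii) The law of $(X_0,V_0)$ has density $f_0\in C^\infty(\mathbb{R}^{2d})$ with $\mathbb E[|\nabla_v\ln f_0(X_0,V_0)|^2]<\infty$, $\mathbb E[|X_0|^4+|V_0|^4]<\infty$ and $\mathcal F(f_0)<\infty$ (with $\mathcal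 F$ below). For a density $f$ on $\mathbb{R}^{2d}$: $K*f(x):=\int_{\mathbb{R}^{2d}}K(x-x')f(x',v')\,\mathrm dx'\mathrm dv'$, $h_f(x,v):=\frac12|v|^2+\frac1mU(x)+\frac1mK*f(x)$, $\check h_f(x,v):=\frac12|v|^2+\frac1mU(x)+\frac1{2m}K*f(x)$. $(X_t,V_t)_{0\le t\le T}$ is the unique strong solution of $$\mathrm dX_t=V_t\,\mathrm dt,\qquad \mathrm dV_t=-\tfrac1m\nabla U(X_t)\,\mathrm dt-\tfrac1m\nabla(K*\rho_t)(X_t)\,\mathrm dt-\tfrac\gamma mV_t\,\mathrm dt+\sigma\,\mathrm dB_t,$$ with $\rho_t=\mathrm{Law}(X_t,V_t)$. Under (i)-(ii), $\rho_t$ has a smooth density $f_t$, strictly positive for $t\in(0,T]$, solving the Vlasov-Fokker-Planck equation $\partial_tf_t+v\cdot\nabla_xf_t-\frac1m\nabla_x(U+K*f_t)\cdot\nabla_vf_t=\frac\gamma m\nabla_v\cdot(vf_t)+\frac{\sigma^2}2\Delta_vf_t$. $G:=\binom{0}{\sigma I_{d\times d}}\in\mathbb{R}^{2d\times d}$. Poisson bracket: $\{f_1,f_2\}:=\nabla_xf_1\cdot\nabla_vf_2-\nabla_vf_1\cdot\nabla_xf_2$. Conservative energy functional: $H(f):=\int_{\mathbb{R}^{2d}}f\,\check h_f\,\mathrm dz$. Free energy: $\mathcal F(f):=\int_{\mathbb{R}^{2d}}(f\ln f+\beta m f\check h_f)\,\mathrm dz$. $\frac{\delta}{\delta f}$ denotes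 the $L^2$ first variation (defined up to additive constants), where the dependence of $\check h_f$ on $f$ is also varied. Poisson operator: $\mathcal L(f)\phi:=-\{f,\phi\}$. Onsager operator: $\mathcal J(f)\psi:=-\operatorname{div}(\frac12GG^\top f\,\nabla\psi)$, for smooth $\phi,\psi$. *)

(* Defs.v *)
From HB Require Import structures.
From mathcomp Require Import all_boot all_order all_algebra.
From mathcomp Require Import all_classical all_reals all_analysis.

Set Implicit Arguments.
Unset Strict Implicit.
Unset Printing Implicit Defensive.

Import Order.TTheory GRing.Theory Num.Theory.
Import numFieldNormedType.Exports.

Local Open Scope classical_set_scope.
Local Open Scope ring_scope.

Section measurable_rV.
Context {dT : measure_display} {T : measurableType dT} (n : nat).

Let coord (i : 'I_n) (x : 'rV[T]_n) : T := x ord0 i.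

Let rV_set0 : g_sigma_preimage coord set0.
Proof. exact: sigma_algebra0. Qed.

Let rV_setC A : g_sigma_preimage coord A -> g_sigma_preimage coord (~` A).
Proof. exact: sigma_algebraC. Qed.

Let rV_bigcup (F : (set 'rV[T]_n)^nat) :
  (forall i, g_sigma_preimage coord (F i)) ->
  g_sigma_preimage coord (\bigcup_i (F i)).
Proof. exact: sigma_algebra_bigcup. Qed.

(* As for tuples in the library: the sigma-algebra generated by the
   coordinates, i.e. the Borel one when [T] is the real line. *)
HB.instance Definition _ := @isMeasurable.Build (measure_tuple_display dT)
  'rV[T]_n (g_sigma_preimage coord) rV_set0 rV_setC rV_bigcup.

Lemma measurable_rV_coord (i : 'I_n) :
  measurable_fun [set: 'rV[T]_n] (fun x : 'rV[T]_n => x ord0 i).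
Proof.
move=> _ Y mY; rewrite setTI; apply: sub_sigma_algebra => /=.
rewrite -bigcup_seq/=; exists i => /=; first by rewrite mem_index_enum.
by exists Y => //; rewrite setTI.
Qed.

Lemma measurable_fun_rVP dS (S : measurableType dS) (f : S -> 'rV[T]_n) :
  (forall i, measurable_fun setT (fun s => f s ord0 i)) ->
  measurable_fun setT f.
Proof.
move=> mf _ A mA; rewrite setTI.
suff : (g_sigma_preimage coord) `<=` [set B | measurable (f @^-1` B)] by apply.
apply: smallest_sub.
  split => [|B|F] /=.
  - by rewrite preimage_set0.
  - by move=> mB; rewrite setTD preimage_setC; exact: measurableC.
  - by move=> mF; rewrite preimage_bigcup; exact: bigcup_measurable.
rewrite -bigcup_seq => B [i _ [Y mY <-]] /=; rewrite setTI.
by have := mf i measurableT Y mY; rewrite setTI.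
Qed.

End measurable_rV.

Section lebesgue_rV.
Context {R : realType}.

(* [measurableTypeR R] is [R] with the display expected by
   [lebesgue_measure]. *)
Definition consrV n (p : measurableTypeR R * 'rV[R]_n) : 'rV[R]_n.+1 :=
  row_mx ((p.1 : R)%:M : 'rV[R]_1) p.2.

Definition unconsrV n (x : 'rV[R]_n.+1) : measurableTypeR R * 'rV[R]_n :=
  (x ord0 ord0, rsubmx (x : 'rV[R]_(1 + n))).

Lemma consrVK n : cancel (@consrV n) (@unconsrV n).
Proof.
case=> a x; rewrite /unconsrV /consrV row_mxKr; congr pair.
transitivity (row_mx (a%:M : 'rV_1) x ord0 (lshift n ord0)).
  by congr (row_mx _ _ _ _); exact/val_inj.
by rewrite row_mxEl mxE eqxx mulr1n.
Qed.

Lemma measurable_consrV n : measurable_fun setT (@consrV n).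
Proof.
apply: measurable_fun_rVP => i.
case: (split_ordP (i : 'I_(1 + n))) => j ->.
  rewrite [X in measurable_fun _ X](_ : _ = fst); first exact: measurable_fst.
  apply/funext => p; apply: (etrans (row_mxEl _ _ _ _)).
  by rewrite (ord1 j) mxE eqxx mulr1n.
rewrite [X in measurable_fun _ X](_ : _ = fun p : measurableTypeR R * 'rV[R]_n => p.2 ord0 j).
  exact: (measurableT_comp (measurable_rV_coord j) measurable_snd).
by apply/funext => p; exact: row_mxEr.
Qed.

Lemma measurable_unconsrV n : measurable_fun setT (@unconsrV n).
Proof.
apply/measurable_fun_pairP; split => /=.
  exact: measurable_rV_coord.
apply: measurable_fun_rVP => i /=.
under eq_fun do rewrite mxE.
exact: measurable_rV_coord.
Qed.

Section cons_measure.
Context n (mu : {sigma_finite_measure set 'rV[R]_n -> \bar R}).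

Definition cons_measure : set 'rV[R]_n.+1 -> \bar R :=
  pushforward (@lebesgue_measure R \x mu)%E (@consrV n).

Let mcons A : measurable A -> measurable (@consrV n @^-1` A).
Proof.
by move=> mA; rewrite -[X in measurable X]setTI; exact: measurable_consrV.
Qed.

Let cons0 : cons_measure set0 = 0%E.
Proof. by rewrite /cons_measure /pushforward preimage_set0 measure0. Qed.

Let cons_ge0 A : (0 <= cons_measure A)%E.
Proof. exact: (measure_ge0 (@lebesgue_measure R \x mu)%E). Qed.

Let cons_sigma_additive : semi_sigma_additive cons_measure.
Proof.
move=> F mF tF mUF; rewrite /cons_measure /pushforward preimage_bigcup.
apply: measure_semi_sigma_additive.
- by move=> k; exact: mcons.
- apply/trivIsetP => /= i j _ _ ij; rewrite -preimage_setI.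
  by move/trivIsetP : tF => /(_ _ _ _ _ ij) ->//; rewrite preimage_set0.
- by rewrite -preimage_bigcup; exact: mcons.
Qed.

HB.instance Definition _ := isMeasure.Build _ _ _ cons_measure
  cons0 cons_ge0 cons_sigma_additive.

Let cons_sigma_finite : sigma_finite setT cons_measure.
Proof.
have /sigma_finiteP[F [TF ndF Foo]] := sigma_finiteT (@lebesgue_measure R).
have /sigma_finiteP[G [TG ndG Goo]] := sigma_finiteT mu.
exists (fun k => @unconsrV n @^-1` (F k `*` G k)).
  rewrite -preimage_bigcup -[LHS](preimage_setT (@unconsrV n)).
  congr (_ @^-1` _); rewrite -setXTT TF TG predeqE => -[x y]; split.
    move=> [/= [i _ Fx] [j _ Gy]]; exists (maxn i j) => //; split.
    - by move: x Fx; exact/subsetPset/ndF/leq_maxl.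
    - by move: y Gy; exact/subsetPset/ndG/leq_maxr.
  by move=> [i _ []/= ? ?]; split; exists i.
move=> k; have [mF Fk] := Foo k; have [mG Gk] := Goo k; split.
  rewrite -[X in measurable X]setTI; apply: measurable_unconsrV => //.
  exact: measurableX.
rewrite /cons_measure /pushforward.
rewrite (_ : _ @^-1` _ = F k `*` G k); last first.
  by apply/funext => p; exact: (congr1 (F k `*` G k) (consrVK p)).
by rewrite product_measure1E// lte_mul_pinfty// ge0_fin_numE.
Qed.

HB.instance Definition _ :=
  Measure_isSigmaFinite.Build _ _ _ cons_measure cons_sigma_finite.

End cons_measure.

(* [R^0] is a point; [R^(n+1)] is [R x R^n] with the product measure. *)
Fixpoint leb (n : nat) : {sigma_finite_measure set 'rV[R]_n -> \bar R} :=
  if n is n'.+1 then cons_measure (leb n') else dirac (0 : 'rV[R]_0).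

End lebesgue_rV.

(* Vectors are rows; a matrix [A] acts on a row [u] as [u *m A^T]. *)
Section calculus.
Context {R : realType}.

Definition dot n (x y : 'rV[R]_n) : R := \sum_i x ord0 i * y ord0 i.

(* The Euclidean norm; the norm of the library on matrices is the sup norm. *)
Definition enorm n (x : 'rV[R]_n) : R := Num.sqrt (dot x x).

Definition pd n (i : 'I_n) (f : 'rV[R]_n -> R) (x : 'rV[R]_n) : R :=
  'D_(delta_mx ord0 i) f x.

Definition pds n (s : seq 'I_n) (f : 'rV[R]_n -> R) : 'rV[R]_n -> R :=
  foldr (@pd n) f s.

Definition smooth n (f : 'rV[R]_n -> R) : Prop :=
  forall s : seq 'I_n, continuous (pds s f) /\
    forall x i, derivable (pds s f) x (delta_mx ord0 i).

Definition grad n (f : 'rV[R]_n -> R) (x : 'rV[R]_n) : 'rV[R]_n :=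
  \row_i pd i f x.

Definition div n (F : 'rV[R]_n -> 'rV[R]_n) (x : 'rV[R]_n) : R :=
  \sum_i pd i (fun y => F y ord0 i) x.

(* |nabla^j f(x)|, with the Euclidean norm on j-tensors *)
Definition nabla_norm n (j : nat) (f : 'rV[R]_n -> R) (x : 'rV[R]_n) : R :=
  Num.sqrt (\sum_(s : j.-tuple 'I_n) pds s f x ^+ 2).

Definition lipschitz_field n (F : 'rV[R]_n -> 'rV[R]_n) : Prop :=
  exists L : R, forall x y, enorm (F x - F y) <= L * enorm (x - y).

(* A point z = (x, v) of the phase space is [row_mx x v]. *)
Definition pos d (z : 'rV[R]_(d + d)) : 'rV[R]_d := lsubmx z.
Definition vel d (z : 'rV[R]_(d + d)) : 'rV[R]_d := rsubmx z.

Definition gradx d (f : 'rV[R]_(d + d) -> R) (z : 'rV[R]_(d + d)) : 'rV[R]_d :=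
  pos (grad f z).
Definition gradv d (f : 'rV[R]_(d + d) -> R) (z : 'rV[R]_(d + d)) : 'rV[R]_d :=
  vel (grad f z).

Definition divv d (F : 'rV[R]_(d + d) -> 'rV[R]_d) (z : 'rV[R]_(d + d)) : R :=
  \sum_i pd (rshift d i) (fun y => F y ord0 i) z.

Definition laplacev d (f : 'rV[R]_(d + d) -> R) : 'rV[R]_(d + d) -> R :=
  divv (gradv f).

Definition poisson d (f1 f2 : 'rV[R]_(d + d) -> R) (z : 'rV[R]_(d + d)) : R :=
  dot (gradx f1 z) (gradv f2 z) - dot (gradv f1 z) (gradx f2 z).

End calculus.

Section energies.
Context {R : realType} (d : nat).
Implicit Types (m gamma beta : R) (U K : 'rV[R]_d -> R) (x : 'rV[R]_d).
Implicit Types (f g eta phi psi : 'rV[R]_(d + d) -> R) (z : 'rV[R]_(d + d)).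

Definition sigma m gamma beta : R := Num.sqrt (2 * gamma / (beta * m ^+ 2)).

Definition has_density (mu : set 'rV[R]_(d + d) -> \bar R) f : Prop :=
  [/\ measurable_fun setT f, forall z, 0 <= f z &
      forall A, measurable A -> mu A = (\int[leb (d + d)]_(z in A) (f z)%:E)%E].

Definition conv K f x : R :=
  \int[leb (d + d)]_z (K (x - pos z) * f z).

Definition conv_law K (mu : set 'rV[R]_(d + d) -> \bar R) x : R :=
  fine (\int[mu]_z (K (x - pos z))%:E)%E.

Definition hamiltonian m U K f z : R :=
  2^-1 * enorm (vel z) ^+ 2 + m^-1 * U (pos z) + m^-1 * conv K f (pos z).

Definition hamiltonian_check m U K f z : R :=
  2^-1 * enorm (vel z) ^+ 2 + m^-1 * U (pos z) + (2 * m)^-1 * conv K f (pos z).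

(* [H(f)] and [F(f)] are the integrals over the phase space of the following
   two functions of [z]. *)
Definition H_integrand m U K f z : R := f z * hamiltonian_check m U K f z.

Definition F_integrand m beta U K f z : R :=
  f z * ln (f z) + beta * m * (f z * hamiltonian_check m U K f z).

Definition conservative_energy m U K f : \bar R :=
  (\int[leb (d + d)]_z (H_integrand m U K f z)%:E)%E.

Definition free_energy m beta U K f : \bar R :=
  (\int[leb (d + d)]_z (F_integrand m beta U K f z)%:E)%E.

Definition perturb f (eps : R) eta : 'rV[R]_(d + d) -> R :=
  fun z => f z + eps * eta z.

(* Compactly supported continuous perturbations of zero mass, so that
   [f + eps eta] keeps the mass of [f]; first variations are thus defined up
   to additive constants. *)
Definition admissible eta : Prop :=
  [/\ continuous eta,
      exists M : R, forall z, M < enorm z -> eta z = 0 &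
      \int[leb (d + d)]_z eta z = 0].

(* [g] is an L^2 first variation at [f] of E(f) := int e(f) dz:
   d/deps E(f + eps eta) = int g eta dz at eps = 0, for all admissible eta.
   The increment E(f + eps eta) - E(f) is written under one integral, which
   makes sense also when E(f) is not known to be finite; see
   [first_variationE] for the case where e(f) is integrable. *)
Definition first_variation
    (e : ('rV[R]_(d + d) -> R) -> 'rV[R]_(d + d) -> R) f g : Prop :=
  smooth g /\ forall eta, admissible eta ->
    (\forall eps \near (0 : R), (leb (d + d)).-integrable setT
        (fun z => (e (perturb f eps eta) z - e f z)%:E)) /\
    is_derive (0 : R) (1 : R)
      (fun eps : R =>
        \int[leb (d + d)]_z (e (perturb f eps eta) z - e f z))
      (\int[leb (d + d)]_z (g z * eta z)).

Lemma first_variationE e f g eta :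
  first_variation e f g -> (leb (d + d)).-integrable setT (EFin \o e f) ->
  admissible eta ->
  is_derive (0 : R) (1 : R)
    (fun eps : R => \int[leb (d + d)]_z e (perturb f eps eta) z)
    (\int[leb (d + d)]_z (g z * eta z)).
Proof.
move=> [_ fv] ief /fv[near_int der].
pose c := \int[leb (d + d)]_z e f z.
rewrite -[X in is_derive _ _ _ X]addr0.
have dsum := is_deriveD der (is_derive_cst c (0 : R) (1 : R)).
apply: (near_eq_is_derive _ dsum).
near=> eps.
have ie : (leb (d + d)).-integrable setT
    (EFin \o (fun z => e (perturb f eps eta) z - e f z)).
  by near: eps.
transitivity (\int[leb (d + d)]_z (e (perturb f eps eta) z - e f z) + c) => //.
rewrite /c -RintegralD//; apply: eq_Rintegral => z _ /=.
by rewrite subrK.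
Unshelve. all: by end_near. Qed.

Definition Gmx m gamma beta : 'M[R]_(d + d, d) :=
  col_mx 0 (sigma m gamma beta)%:M.

Definition poisson_op f phi z : R := - poisson f phi z.

Definition diffusion_flux m gamma beta f psi z : 'rV[R]_(d + d) :=
  grad psi z *m
    (((2^-1 * f z) *: (Gmx m gamma beta *m (Gmx m gamma beta)^T))^T).

Definition onsager_op m gamma beta f psi z : R :=
  - div (diffusion_flux m gamma beta f psi) z.

End energies.

Section process.
Context {R : realType} (d : nat) {dO : measure_display}
  {Omega : measurableType dO} (P : probability Omega R).
Implicit Types (FF : R -> set (set Omega)) (B X V : R -> Omega -> 'rV[R]_d).

Record normal_filtration FF : Prop := NormalFiltration {
  nf_sigma : forall t : R, 0 <= t -> sigma_algebra setT (FF t) ;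
  nf_sub : forall t : R, 0 <= t -> FF t `<=` measurable ;
  nf_mono : forall s t : R, 0 <= s -> s <= t -> FF s `<=` FF t ;
  nf_right : forall t : R, 0 <= t -> \bigcap_(s in [set s | t < s]) FF s `<=` FF t ;
  nf_null : forall A, measurable A -> P A = 0%E -> FF 0 A }.

Definition measurable_wrt (G : set (set Omega)) n (Y : Omega -> 'rV[R]_n) :=
  forall A, measurable A -> G (Y @^-1` A).

Record brownian_motion FF B : Prop := BrownianMotion {
  bm_adapted : forall t : R, 0 <= t -> measurable_wrt (FF t) (B t) ;
  bm_zero : {ae P, forall w, B 0 w = 0} ;
  bm_path : {ae P, forall w, {within `[0, +oo[, continuous (B ^~ w)}} ;
  bm_normal : forall s t : R, 0 <= s -> s < t ->
    forall C : 'I_d -> set R, (forall i, measurable (C i)) ->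
    P [set w | forall i, C i ((B t w - B s w) ord0 i)] =
    (\prod_(i < d) normal_prob 0 (Num.sqrt (t - s)) (C i))%E ;
  bm_indep : forall s t : R, 0 <= s -> s < t ->
    forall A (C : set 'rV[R]_d), FF s A -> measurable C ->
    P (A `&` [set w | C (B t w - B s w)]) =
    (P A * P [set w | C (B t w - B s w)%R])%E }.

Definition law X V t : set 'rV[R]_(d + d) -> \bar R :=
  pushforward P (fun w => row_mx (X t w) (V t w)).

Definition drift m gamma (U K : 'rV[R]_d -> R) X V (s : R) (w : Omega)
    : 'rV[R]_d :=
  - m^-1 *: grad U (X s w) - m^-1 *: grad (conv_law K (law X V s)) (X s w)
  - (gamma / m) *: V s w.

(* The noise is additive, so the equation in integral form involves no
   stochastic integral. The bound on second moments is part of the notion of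
   solution: [K] may grow quadratically, and [K * rho_t] has to exist. *)
Record langevin_solution m gamma beta (T : R) (U K : 'rV[R]_d -> R) FF B X V
    : Prop := LangevinSolution {
  ls_adapted : forall t : R, 0 <= t <= T ->
    measurable_wrt (FF t) (X t) /\ measurable_wrt (FF t) (V t) ;
  ls_path : {ae P, forall w, {within `[0, T], continuous (X ^~ w)} /\
                             {within `[0, T], continuous (V ^~ w)}} ;
  ls_moment : exists C : R, forall t : R, 0 <= t <= T ->
    (\int[P]_w (enorm (X t w) ^+ 2 + enorm (V t w) ^+ 2)%R%:E <= C%:E)%E ;
  ls_drift : {ae P, forall w, forall i,
    (@lebesgue_measure R).-integrable `[0, T]
      (fun s => (drift m gamma U K X V s w ord0 i)%:E)} ;
  ls_eqX : {ae P, forall w, forall t i, 0 <= t <= T ->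
    X t w ord0 i =
    X 0 w ord0 i + \int[lebesgue_measure]_(s in `[0, t]) V s w ord0 i} ;
  ls_eqV : {ae P, forall w, forall t i, 0 <= t <= T ->
    V t w ord0 i =
    V 0 w ord0 i
    + \int[lebesgue_measure]_(s in `[0, t]) drift m gamma U K X V s w ord0 i
    + sigma m gamma beta * B t w ord0 i} }.

Record regular_potentials (U K : 'rV[R]_d -> R) : Prop := RegularPotentials {
  rp_smoothU : smooth U ;
  rp_smoothK : smooth K ;
  rp_ge0U : forall x, 0 <= U x ;
  rp_ge0K : forall x, 0 <= K x ;
  rp_symK : forall x, K (- x) = K x ;
  rp_growthU : exists2 kappa : R, 0 < kappa &
    forall x, kappa * enorm x ^+ 2 <= U x ;
  rp_lipU : lipschitz_field (grad U) ;
  rp_lipK : lipschitz_field (grad K) ;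
  rp_bounded : forall j, (2 <= j)%N -> exists C : R,
    forall x, nabla_norm j U x <= C /\ nabla_norm j K x <= C }.

(* [f0] may vanish, but [f0 (X_0, V_0) > 0] almost surely, so the values of
   the score where [f0] is zero do not matter. *)
Record regular_initial m beta (U K : 'rV[R]_d -> R)
    (f0 : 'rV[R]_(d + d) -> R) X V : Prop := RegularInitial {
  ri_density : has_density (law X V 0) f0 ;
  ri_smooth : smooth f0 ;
  ri_score : (\int[P]_w
    (enorm (gradv (fun z => ln (f0 z)) (row_mx (X 0 w) (V 0 w))) ^+ 2)%R%:E
    < +oo)%E ;
  ri_moment : (\int[P]_w (enorm (X 0%R w) ^+ 4 + enorm (V 0%R w) ^+ 4)%R%:E < +oo)%E ;
  ri_free_energy : (free_energy m beta U K f0 < +oo)%E }.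

Record density_flow m gamma beta (T : R) (U K : 'rV[R]_d -> R) X V
    (f : R -> 'rV[R]_(d + d) -> R) : Prop := DensityFlow {
  df_density : forall t : R, 0 <= t <= T -> has_density (law X V t) (f t) ;
  df_smooth : forall t : R, 0 <= t <= T -> smooth (f t) ;
  df_pos : forall t : R, 0 < t <= T -> forall z, 0 < f t z ;
  df_derivable : forall t : R, 0 < t < T -> forall z, derivable (f ^~ z) t 1 ;
  df_vfp : forall t : R, 0 < t < T -> forall z,
    derive1 (f ^~ z) t + dot (vel z) (gradx (f t) z)
    - m^-1 * dot (grad (fun x => U x + conv K (f t) x) (pos z))
                 (gradv (f t) z) =
    gamma / m * divv (fun y => f t y *: vel y) z
    + sigma m gamma beta ^+ 2 / 2 * laplacev (f t) z }.

End process.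

(* Main.v *)
(** The first variations are computed from second-order expansions: for every
    admissible direction [eta], the increment of the energy density along
    [f + eps eta] is [eps a + O(eps^2 b)] with [a] and [b] integrable, so no
    theorem on differentiation under the integral sign is needed. For the
    entropy the remainder is controlled by [eta^2 / f], for the interaction
    energy the expansion is exact, and the symmetry of [K] gives
    [int f (K * eta) = int eta (K * f)]; this is why the factor [1/2] in
    [hamiltonian_check] disappears in [hamiltonian]. The same idea shows that
    [K * f] is smooth: [K] and its derivatives grow at most quadratically
    and [f] has finite second moments, by the moment bound of the solution.

    A first variation is unique up to an additive constant: if [u] is the
    difference of two of them, one tests against [eta = chi (u - c)], where
    [chi] is a continuous cutoff and [c] the [chi]-average of [u], which gives
    [int chi (u - c)^2 = 0]. The operators only see gradients, and the GENERIC
    equation becomes the Vlasov-Fokker-Planck equation since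
    [sigma^2 / 2 * beta * m = gamma / m]. *)

Require Import Defs.
From HB Require Import structures.
From mathcomp Require Import all_boot all_order all_algebra.
From mathcomp Require Import all_classical all_reals all_analysis.
From mathcomp Require Import measurable_realfun.
From mathcomp Require Import ring lra.

Set Implicit Arguments.
Unset Strict Implicit.
Unset Printing Implicit Defensive.

Import Order.TTheory GRing.Theory Num.Theory.
Import numFieldNormedType.Exports.

Local Open Scope classical_set_scope.
Local Open Scope ring_scope.

(* The library's convex combinations, imported after [Defs], hide [Defs.conv]. *)
Local Notation conv := Defs.conv.

(** * Derivatives along lines and smooth functions *)

Section directional_calculus.
Context {R : realType} {V : normedModType R}.
Implicit Types (g : V -> R) (x e : V).

Lemma is_derive_line g x e : (forall y, derivable g y e) ->
  forall s : R, is_derive s 1 (fun s => g (x + s *: e)) ('D_e g (x + s *: e)).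
Proof.
move=> dg s.
have E : (fun h : R => h^-1 *: (((fun s => g (x + s *: e)) \o shift s) (h *: 1)
                                - g (x + s *: e))) =
         (fun h : R => h^-1 *: ((g \o shift (x + s *: e)) (h *: e)
                                - g (x + s *: e))).
  by apply/funext => h /=; rewrite [_%:A]mulr1 scalerDl addrCA.
by split; [rewrite /derivable E; exact: dg|rewrite /derive E].
Qed.

Lemma MVT_line g x e (h : R) : (forall y, derivable g y e) ->
  exists2 c : R, `|c| <= `|h| & g (x + h *: e) - g x = h * 'D_e g (x + c *: e).
Proof.
move=> dg; pose phi (s : R) := g (x + s *: e).
have dphi (s : R) : is_derive s 1 phi ('D_e g (x + s *: e)).
  exact: is_derive_line.
have cphi (a b : R) : {within `[a, b], continuous phi}.
  by apply: derivable_within_continuous => s _; have [] := dphi s.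
have phi0 : phi 0 = g x by rewrite /phi scale0r addr0.
have [h0|h0] := leP 0 h.
  have [c] := MVT_segment h0 (fun s _ => dphi s) (cphi _ _).
  rewrite phi0 in_itv /= => /andP[c0 ch] E; exists c.
    by rewrite !ger0_norm.
  by rewrite -/(phi h) E subr0 mulrC.
have [c] := MVT_segment (ltW h0) (fun s _ => dphi s) (cphi _ _).
rewrite phi0 in_itv /= => /andP[c0 ch] E; exists c.
  by rewrite !ler0_norm ?lerN2// ltW.
by rewrite -/(phi h) -opprB E sub0r mulrN opprK mulrC.
Qed.

(** Two mean value steps: one for [g] between [x] and [x + h e], one for its directional derivative
    between [x] and the intermediate point. The factor is 1 instead of 1/2, which does no harm to a
    remainder estimate. *)
Lemma taylor_line g x e (h M : R) :
  (forall y, derivable g y e) -> (forall y, derivable ('D_e g) y e) ->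
  (forall s : R, `|s| <= `|h| -> `|'D_e ('D_e g) (x + s *: e)| <= M) ->
  `|g (x + h *: e) - g x - h * 'D_e g x| <= M * h ^+ 2.
Proof.
move=> dg ddg bM.
have [c ch ->] := MVT_line x h dg.
rewrite -mulrBr; have [c' c'c ->] := MVT_line x c ddg.
rewrite mulrA normrM mulrC; apply: ler_pM => //.
  by apply: bM; exact: le_trans c'c ch.
by rewrite normrM -real_normK ?num_real// expr2 ler_wpM2l.
Qed.

(** A quadratic remainder keeps the difference quotient within a multiple of [|h|] of [l]. This
    criterion serves for convolutions, for the kinetic energy and for the derivatives in [eps] that
    define first variations. *)
Lemma is_derive_quadratic g x e (l C r : R) : 0 < r ->
  (forall h : R, `|h| < r -> `|g (x + h *: e) - g x - h * l| <= C * h ^+ 2) ->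
  is_derive x e g l.
Proof.
move=> r0 H.
have cv : (fun h => h^-1 *: ((g \o shift x) (h *: e) - g x)) @ 0^' --> l.
  apply/cvgrPdist_lt => /= eps eps0; near=> h.
  have h0 : h != 0 by near: h; exact: nbhs_dnbhs_neq.
  have hr : `|h| < r.
    near: h; apply: dnbhs0_lt; exact: r0.
  have hC : `|h| < eps / (`|C| + 1).
    near: h; apply: dnbhs0_lt; by rewrite divr_gt0// ltr_wpDl.
  rewrite distrC [X in `|X|](_ : _ = h^-1 * (g (x + h *: e) - g x - h * l)).
    rewrite normrM normfV.
    have hp : 0 < `|h| by rewrite normr_gt0.
    apply: (@le_lt_trans _ _ (`|h|^-1 * (C * h ^+ 2))).
      by rewrite ler_wpM2l ?invr_ge0// H.
    have -> : h ^+ 2 = `|h| ^+ 2 by rewrite real_normK// num_real.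
    rewrite expr2 mulrCA mulrA mulrA mulrAC mulfK ?gt_eqF//.
    apply: (@le_lt_trans _ _ ((`|C| + 1) * `|h|)).
      by rewrite ler_wpM2r// (le_trans (ler_norm _))// lerDl.
    by rewrite mulrC -ltr_pdivlMr// ltr_wpDl.
  by rewrite /= mulrBr mulKf// [x + _]addrC.
by split; [apply/cvg_ex; exists l|exact/cvg_lim].
Unshelve. all: by end_near. Qed.

End directional_calculus.

(** * Partial derivatives and stability properties of smooth functions *)

Section partial_derivatives.
Context {R : realType} {n : nat}.
Implicit Types (g : 'rV[R]_n -> R) (x y : 'rV[R]_n).

Lemma ler_coord_norm x i : `|x ord0 i| <= `|x|.
Proof.
rewrite [leRHS]/Num.norm/= mx_normrE.
by apply/bigmax_geP; right; exists (ord0, i).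
Qed.

Lemma ler_norm_coord x (M : R) : 0 <= M -> (forall i, `|x ord0 i| <= M) -> `|x| <= M.
Proof.
move=> M0 H; rewrite [leLHS]/Num.norm/= mx_normrE.
by apply/bigmax_leP; split=> // -[i j] _ /=; rewrite (ord1 i).
Qed.

Lemma mean_value_coord g x y (M : R) :
  (forall i w, derivable g w (delta_mx ord0 i)) ->
  (forall i w, `|w - x| <= `|y - x| -> `|pd i g w| <= M) ->
  `|g y - g x| <= n%:R * M * `|y - x|.
Proof.
move=> dg bM.
(* only partial derivatives are available: go from [x] to [y] one coordinate
   at a time *)
pose w (k : nat) : 'rV[R]_n := \row_j (if (j < k)%N then y ord0 j else x ord0 j).
have w0 : w 0%N = x by apply/rowP => j; rewrite mxE.
have wn : w n = y by apply/rowP => j; rewrite mxE ltn_ord.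
rewrite -[in g y]wn -[in g x]w0 -(@telescope_sumr _ 0 n (g \o w))// big_mkord.
apply: le_trans (ler_norm_sum _ _ _) _.
have -> : n%:R * M * `|y - x| = \sum_(k < n) M * `|y - x|.
  by rewrite sumr_const card_ord -mulrA mulr_natl.
apply: ler_sum => k _ /=.
have -> : w k.+1 = w k + (y ord0 k - x ord0 k) *: delta_mx ord0 k.
  apply/rowP => j; rewrite !mxE eqxx /= ltnS leq_eqVlt.
  have [->|jk] := eqVneq j k; first by rewrite eqxx ltnn mulr1 subrKC.
  by rewrite (negbTE jk : (j == k :> nat) = false) mulr0 addr0.
have [c ch ->] := MVT_line (w k) (y ord0 k - x ord0 k) (dg k).
rewrite normrM mulrC; apply: ler_pM => //.
  (* The intermediate point stays in the sup-norm ball where [bM] applies: each of its coordinates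
     differs from that of [x] by at most [|y - x|]. *)
  apply: bM; apply: ler_norm_coord => // j; rewrite !mxE eqxx /=.
  have cj := ler_coord_norm (y - x) j; rewrite !mxE in cj.
  have [jk|kj] := ltnP j k.
    by rewrite (ltn_eqF jk : (j == k) = false) mulr0 addr0.
  have [jk|jk] := eqVneq j k; last by rewrite mulr0 addr0 subrr normr0.
  by rewrite jk mulr1 addrAC subrr add0r; rewrite jk in cj; exact: le_trans cj.
by have := ler_coord_norm (y - x) k; rewrite !mxE.
Qed.

Lemma near_ball_norm x (e : R) : 0 < e -> \forall y \near x, `|y - x| < e.
Proof.
move=> e0; apply: filterS (nbhsx_ballx x e e0) => y.
by rewrite -ball_normE /= distrC.
Qed.

(** Existence of partial derivatives does not imply continuity; local bounds on them do, since
    [mean_value_coord] then gives a local Lipschitz estimate. *)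
Lemma continuous_bounded_pd g :
  (forall i w, derivable g w (delta_mx ord0 i)) ->
  (forall x, exists M : R, forall i w, `|w - x| <= 1 -> `|pd i g w| <= M) ->
  continuous g.
Proof.
move=> dg bM x; have [M HM] := bM x.
apply/(@cvgrPdist_lt _ _ _ (nbhs x) (@nbhs_filter _ x)) => /= eps eps0; near=> y.
have y1 : `|y - x| <= 1 by rewrite ltW//; near: y; exact: near_ball_norm.
have y2 : `|y - x| < eps / (n%:R * `|M| + 1).
  near: y; apply: near_ball_norm; rewrite divr_gt0// ltr_wpDl// mulr_ge0.
rewrite distrC; apply: (@le_lt_trans _ _ (n%:R * M * `|y - x|)).
  by apply: mean_value_coord => // i w wy; apply: HM; exact: le_trans wy y1.
apply: (@le_lt_trans _ _ ((n%:R * `|M| + 1) * `|y - x|)).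
  rewrite ler_wpM2r//; apply: (@le_trans _ _ (n%:R * `|M|)).
    by rewrite ler_wpM2l// ler_norm.
  by rewrite lerDl.
by rewrite mulrC -ltr_pdivlMr// ltr_wpDl// mulr_ge0.
Unshelve. all: by end_near. Qed.

Lemma smooth_continuous g : smooth g -> continuous g.
Proof. by move=> /(_ [::])[]. Qed.

Lemma smooth_derivable g : smooth g -> forall i x, derivable g x (delta_mx ord0 i).
Proof. by move=> /(_ [::])[_ +] i x; exact. Qed.

Lemma smooth_pd g i : smooth g -> smooth (pd i g).
Proof.
move=> sg s; have := sg (rcons s i); rewrite /pds foldr_rcons; exact.
Qed.

(** A coinduction principle: a class of continuous functions that have partial derivatives and is
    stable under them contains only smooth functions. It replaces inductions on words of partial
    derivatives. *)
Lemma smooth_coind (S : ('rV[R]_n -> R) -> Prop) :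
  (forall g, S g -> continuous g /\
     forall i, (forall x, derivable g x (delta_mx ord0 i)) /\ S (pd i g)) ->
  forall g, S g -> smooth g.
Proof.
move=> HS g Sg.
have Sp s : S (pds s g).
  by elim: s => //= i s ih; have [_ /(_ i)[]] := HS _ ih.
move=> s; have [cg dg] := HS _ (Sp s).
by split => // x i; have [] := dg i.
Qed.

Lemma smooth_cst (c : R) : smooth (fun _ : 'rV[R]_n => c).
Proof.
apply: (@smooth_coind (fun g => exists c : R, g = cst c) _ _ (ex_intro _ c erefl)).
move=> g [{}c ->]; split; first by move=> x; apply: cst_continuous.
move=> i; split; first by move=> x; exact: derivable_cst.
by exists 0; apply/funext => x; rewrite /pd derive_cst.
Qed.

(* A class stable under [pd] that contains products and logarithms: closure
   under multiplication, stated for [smooth] alone, would need the Leibniz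
   formula for iterated derivatives. *)
Inductive smooth_closure : ('rV[R]_n -> R) -> Prop :=
| SmoothBase g : smooth g -> smooth_closure g
| SmoothAdd g1 g2 : smooth_closure g1 -> smooth_closure g2 ->
    smooth_closure (g1 + g2)
| SmoothMul g1 g2 : smooth_closure g1 -> smooth_closure g2 ->
    smooth_closure (g1 * g2)
| SmoothInv g : smooth g -> (forall x, 0 < g x) ->
    smooth_closure (fun x => (g x)^-1)
| SmoothLn g : smooth g -> (forall x, 0 < g x) ->
    smooth_closure (fun x => ln (g x)).

Lemma is_derive_ln_comp g x (e : 'rV[R]_n) : 0 < g x -> derivable g x e ->
  is_derive x e (fun y => ln (g y)) ((g x)^-1 * 'D_e g x).
Proof.
(* Only differentiability in the direction [e] is available, so the chain rule is applied to the
   restriction of [g] to a line. *)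
move=> gx dg; pose phi (s : R) := g (s *: e + x).
have dphi : derivable phi 0 1 by exact: (derivable1P _ _ _).1 dg.
have phi0 : phi 0 = g x by rewrite /phi scale0r add0r.
have dln : is_derive (phi 0) 1 (@ln R) (g x)^-1.
  by rewrite phi0; exact: is_derive1_ln.
have dcomp : is_derive (0 : R) 1 (@ln R \o phi : R -> R) ((g x)^-1 * 'D_e g x).
  have dl : derivable (@ln R) (phi 0) 1 by have [] := dln.
  apply: DeriveDef.
    by apply/derivable1_diffP/differentiable_comp; exact/derivable1_diffP.
  rewrite -derive1E (derive1_comp dphi dl) !derive1E; congr (_ * _).
    by have [] := dln.
  apply: (congr1 (fun F : R -> R => lim (F @ 0^'))); apply/funext => h /=.
  by rewrite /phi /= addr0 [_%:A]mulr1 scale0r add0r.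
split; first by have [d1 _] := dcomp; exact: (derivable1P _ _ _).2 d1.
have [_ <-] := dcomp.
apply: (congr1 (fun F : R -> R => lim (F @ 0^'))); apply/funext => h /=.
by rewrite /phi /= addr0 [_%:A]mulr1 scale0r add0r.
Qed.

(** The class is stable under [pd]: sums and products by the usual rules, [ln g] because its
    derivative is [g^-1] times that of [g], and [g^-1] because its derivative is [- (g^-1)^2] times
    that of [g]. *)
Lemma smooth_closure_smooth g : smooth_closure g -> smooth g.
Proof.
apply: smooth_coind => {}g; elim=> {g}.
- move=> g sg; split; first exact: smooth_continuous.
  move=> i; split; first by move=> x; exact: smooth_derivable.
  by apply: SmoothBase; exact: smooth_pd.
- move=> g1 g2 s1 [c1 d1] s2 [c2 d2]; split.
    by move=> x; exact: (@continuousD _ _ _ g1 g2 x (c1 x) (c2 x)).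
  move=> i; have [{}d1 p1] := d1 i; have [{}d2 p2] := d2 i; split.
    by move=> x; exact: derivableD.
  rewrite (_ : pd i _ = pd i g1 + pd i g2); first exact: SmoothAdd.
  by apply/funext => x; rewrite /pd deriveD.
- move=> g1 g2 s1 [c1 d1] s2 [c2 d2]; split.
    by move=> x; exact: (@continuousM _ _ g1 g2 x (c1 x) (c2 x)).
  move=> i; have [{}d1 p1] := d1 i; have [{}d2 p2] := d2 i; split.
    by move=> x; exact: derivableM.
  rewrite (_ : pd i _ = g1 * pd i g2 + g2 * pd i g1).
    by apply: SmoothAdd; exact: SmoothMul.
  by apply/funext => x; rewrite /pd deriveM.
- move=> g sg g0; split.
    move=> x; apply: (@continuousV _ _ g x); first by rewrite gt_eqF.
    exact: smooth_continuous.
  move=> i; split.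
    by move=> x; apply: derivableV; [rewrite gt_eqF|exact: smooth_derivable].
  rewrite (_ : pd i _ = cst (- 1) * (((fun x => (g x)^-1) * (fun x => (g x)^-1))
                          * pd i g)).
    apply: SmoothMul; first by apply: SmoothBase; exact: smooth_cst.
    apply: SmoothMul; first by apply: SmoothMul; exact: SmoothInv.
    by apply: SmoothBase; exact: smooth_pd.
  apply/funext => x; rewrite /pd deriveV ?gt_eqF//; last exact: smooth_derivable.
  by rewrite -exprVn scaleNr expr2 [in RHS]/GRing.mul/= mulN1r.
- move=> g sg g0.
  have dl i x : is_derive x (delta_mx ord0 i) (fun y => ln (g y))
                  ((g x)^-1 * pd i g x).
    by apply: is_derive_ln_comp => //; exact: smooth_derivable.
  split.
    move=> x; apply: (continuous_comp (f := g) (g := @ln R)).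
      exact: smooth_continuous.
    exact: continuous_ln.
  move=> i; split; first by move=> x; have [] := dl i x.
  rewrite (_ : pd i _ = (fun x => (g x)^-1) * pd i g).
    by apply: SmoothMul; [exact: SmoothInv|apply: SmoothBase; exact: smooth_pd].
  by apply/funext => x; rewrite /pd derive_val.
Qed.

Lemma smoothD g1 g2 : smooth g1 -> smooth g2 -> smooth (fun x => g1 x + g2 x).
Proof.
by move=> s1 s2; apply/smooth_closure_smooth/SmoothAdd; exact: SmoothBase.
Qed.

Lemma smoothM g1 g2 : smooth g1 -> smooth g2 -> smooth (fun x => g1 x * g2 x).
Proof.
by move=> s1 s2; apply/smooth_closure_smooth/SmoothMul; exact: SmoothBase.
Qed.

Lemma smoothZ (c : R) g : smooth g -> smooth (fun x => c * g x).
Proof. by move=> sg; apply: smoothM => //; exact: smooth_cst. Qed.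

Lemma smooth_ln g : smooth g -> (forall x, 0 < g x) -> smooth (fun x => ln (g x)).
Proof. by move=> sg g0; exact/smooth_closure_smooth/SmoothLn. Qed.

Lemma smooth_sum m (g : 'I_m -> 'rV[R]_n -> R) :
  (forall i, smooth (g i)) -> smooth (fun x => \sum_i g i x).
Proof.
move=> sg.
have : smooth (\sum_i g i).
  by elim/big_ind : _ => // [|*]; [exact: smooth_cst|exact: smoothD].
by congr smooth; apply/funext => x; rewrite fct_sumE.
Qed.

Lemma is_derive_coord i j x :
  is_derive x (delta_mx ord0 j) (fun y : 'rV[R]_n => y ord0 i) (i == j)%:R.
Proof.
apply: (@is_derive_quadratic _ _ _ _ _ _ 0 1) => // h _.
by rewrite !mxE eqxx /= [X in `|X|](_ : _ = 0) ?normr0 ?mul0r//; ring.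
Qed.

Lemma smooth_coord i : smooth (fun y : 'rV[R]_n => y ord0 i).
Proof.
apply: (@smooth_coind (fun g => smooth g \/ g = fun y => y ord0 i) _ _ (or_intror erefl)).
move=> g [sg|->].
  split; first exact: smooth_continuous.
  move=> j; split; first by move=> x; exact: smooth_derivable.
  by left; exact: smooth_pd.
split; first by move=> x; exact: coord_continuous.
move=> j; split; first by move=> x; have [] := is_derive_coord i j x.
left; rewrite (_ : pd _ _ = fun=> (i == j)%:R); first exact: smooth_cst.
by apply/funext => x; rewrite /pd; have [] := is_derive_coord i j x.
Qed.

End partial_derivatives.

(** * Phase space and quadratic growth *)

Section euclidean.
Context {R : realType} {n : nat}.
Implicit Types (x y : 'rV[R]_n).

Lemma dot_ge0 x : 0 <= dot x x.
Proof. by apply: sumr_ge0 => i _; rewrite -expr2 sqr_ge0. Qed.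

Lemma sqr_enorm x : enorm x ^+ 2 = dot x x.
Proof. by rewrite sqr_sqrtr// dot_ge0. Qed.

Lemma enorm_ge0 x : 0 <= enorm x.
Proof. exact: sqrtr_ge0. Qed.

Lemma ler_sqr_coord_dot x i : x ord0 i ^+ 2 <= dot x x.
Proof.
rewrite /dot (bigD1 i)//= -expr2 lerDl sumr_ge0// => j _.
by rewrite -expr2 sqr_ge0.
Qed.

Lemma ler_coord_enorm x i : `|x ord0 i| <= enorm x.
Proof. by rewrite -sqrtr_sqr ler_wsqrtr// ler_sqr_coord_dot. Qed.

Lemma ler_norm_enorm x : `|x| <= enorm x.
Proof.
by apply: ler_norm_coord => [|i]; [exact: enorm_ge0|exact: ler_coord_enorm].
Qed.

Lemma ler_sqr_norm_dot x : `|x| ^+ 2 <= dot x x.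
Proof. by rewrite -sqr_enorm lerXn2r ?nnegrE ?enorm_ge0// ler_norm_enorm. Qed.

Lemma ler_enorm_norm x : enorm x <= n%:R * `|x|.
Proof.
rewrite -[leRHS]ger0_norm; last by rewrite mulr_ge0.
rewrite -sqrtr_sqr ler_wsqrtr// exprMn.
apply: (@le_trans _ _ (n%:R * `|x| ^+ 2)).
  have -> : n%:R * `|x| ^+ 2 = \sum_(i < n) `|x| ^+ 2.
    by rewrite sumr_const card_ord mulr_natl.
  apply: ler_sum => i _.
  by rewrite -expr2 -real_normK ?num_real// lerXn2r ?nnegrE// ler_coord_norm.
rewrite ler_wpM2r ?sqr_ge0// -natrX ler_nat.
by case: (n) => // k; rewrite expnS leq_pmulr// expn1.
Qed.

Lemma ler_dotB x y : dot (x - y) (x - y) <= 2 * dot x x + 2 * dot y y.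
Proof.
rewrite /dot !mulr_sumr -big_split /=; apply: ler_sum => i _.
rewrite !mxE; set a := x _ _; set b := y _ _.
have : 0 <= (a + b) ^+ 2 by exact: sqr_ge0.
by nra.
Qed.

End euclidean.

(** * Position and velocity components *)

Section phase_space.
Context {R : realType} {d : nat}.
Implicit Types (g : 'rV[R]_d -> R) (x y : 'rV[R]_d) (z : 'rV[R]_(d + d)).

Lemma pos_coord z i : pos z ord0 i = z ord0 (lshift d i).
Proof. by rewrite mxE. Qed.

Lemma vel_coord z i : vel z ord0 i = z ord0 (rshift d i).
Proof. by rewrite mxE. Qed.

Lemma dot_pos_vel z : dot z z = dot (pos z) (pos z) + dot (vel z) (vel z).
Proof.
rewrite /dot big_split_ord /=; congr (_ + _); apply: eq_bigr => i _.
  by rewrite !pos_coord.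
by rewrite !vel_coord.
Qed.

Lemma ler_dot_pos z : dot (pos z) (pos z) <= dot z z.
Proof. by rewrite dot_pos_vel lerDl dot_ge0. Qed.

Lemma pos_line z (h : R) i :
  pos (z + h *: delta_mx ord0 (lshift d i)) = pos z + h *: delta_mx ord0 i.
Proof.
by apply/rowP => j; rewrite !mxE eqxx /=.
Qed.

Lemma pos_line_vel z (h : R) i :
  pos (z + h *: delta_mx ord0 (rshift d i)) = pos z.
Proof.
by apply/rowP => j; rewrite !mxE eqxx /= eq_lrshift mulr0 addr0.
Qed.

Lemma is_derive_pos g z i l : is_derive (pos z) (delta_mx ord0 i) g l ->
  is_derive z (delta_mx ord0 (lshift d i)) (g \o @pos R d) l.
Proof.
have E : (fun h : R => h^-1 *: (((g \o @pos R d) \o shift z)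
              (h *: delta_mx ord0 (lshift d i)) - (g \o @pos R d) z)) =
         (fun h : R => h^-1 *: ((g \o shift (pos z)) (h *: delta_mx ord0 i)
              - g (pos z))).
  apply/funext => h /=.
  by rewrite (addrC (h *: _) z) (addrC (h *: _) (pos z)) pos_line.
by move=> [dg <-]; split; [rewrite /derivable E|rewrite /derive E].
Qed.

Lemma is_derive_pos_vel g z i :
  is_derive z (delta_mx ord0 (rshift d i)) (g \o @pos R d) 0.
Proof.
apply: (@is_derive_quadratic _ _ _ _ _ _ 0 1) => // h _ /=.
by rewrite pos_line_vel mulr0 subr0 subrr normr0 mul0r.
Qed.

Lemma continuous_pos : continuous (@pos R d).
Proof. by move=> z; apply/differentiable_continuous/differentiable_lsubmx. Qed.

Lemma smooth_comp_pos g : smooth g -> smooth (g \o @pos R d).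
Proof.
move=> sg; apply: (@smooth_coind _ _
  (fun k => exists2 g, smooth g & k = g \o @pos R d) _ _ (ex_intro2 _ _ g sg erefl)).
move=> _ [{sg}g sg ->]; split.
  move=> z; apply: continuous_comp; first exact: continuous_pos.
  exact: smooth_continuous.
move=> i; case: (split_ordP i) => j ->.
  have D z : is_derive z (delta_mx ord0 (lshift d j)) (g \o @pos R d) (pd j g (pos z)).
    by apply/is_derive_pos/derivableP; exact: smooth_derivable.
  split; first by move=> z; have [] := D z.
  exists (pd j g); first exact: smooth_pd.
  by apply/funext => z; rewrite /pd; have [] := D z.
have D z := is_derive_pos_vel g z j.
split; first by move=> z; have [] := D z.
exists (fun=> 0); first exact: smooth_cst.
by apply/funext => z; rewrite /pd; have [] := D z.
Qed.

Lemma smooth_kinetic : smooth (fun z => 2^-1 * enorm (vel z) ^+ 2).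
Proof.
apply: smoothZ; under eq_fun do rewrite sqr_enorm.
apply: smooth_sum => i; under eq_fun do rewrite vel_coord.
by apply: smoothM; exact: smooth_coord.
Qed.

Lemma is_derive_kinetic_pos z i :
  is_derive z (delta_mx ord0 (lshift d i)) (fun z => 2^-1 * enorm (vel z) ^+ 2) 0.
Proof.
apply: (@is_derive_quadratic _ _ _ _ _ _ 0 1) => // h _ /=.
rewrite [X in `|X|](_ : _ = 0) ?normr0 ?mul0r//.
rewrite !sqr_enorm mulr0 subr0 -mulrBr -[RHS](mulr0 2^-1); congr (_ * _).
apply/eqP; rewrite subr_eq0; apply/eqP/eq_bigr => j _.
by rewrite !mxE eqxx /= eq_rlshift mulr0 addr0.
Qed.

Lemma is_derive_kinetic_vel z i :
  is_derive z (delta_mx ord0 (rshift d i)) (fun z => 2^-1 * enorm (vel z) ^+ 2)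
    (vel z ord0 i).
Proof.
apply: (@is_derive_quadratic _ _ _ _ _ _ 2^-1 1) => // h _ /=.
rewrite !sqr_enorm /dot (bigD1 i)//= [in X in _ - X - _](bigD1 i)//=.
rewrite [X in _ * (_ + X) - _ - _](_ : _ = \sum_(j < d | j != i) vel z ord0 j * vel z ord0 j).
  rewrite !mxE !eqxx /= mulr1 [X in `|X|](_ : _ = 2^-1 * h ^+ 2); last by field.
  by rewrite ger0_norm// mulr_ge0// sqr_ge0.
apply: eq_bigr => j ji; rewrite !mxE eqxx /= (inj_eq (@rshift_inj _ _)).
by rewrite (negbTE ji) mulr0 addr0.
Qed.

End phase_space.

(** * Growth of the potentials and of their derivatives *)

Section growth.
Context {R : realType} {n : nat}.
Implicit Types (g : 'rV[R]_n -> R).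

(** The growth that a finite second moment can integrate. *)
Definition quadratic_growth g : Prop :=
  exists2 C : R, 0 <= C & forall y, `|g y| <= C * (1 + dot y y).

Lemma lipschitz_pd_growth g : lipschitz_field (grad g) ->
  exists2 C : R, 0 <= C & forall i y, `|pd i g y| <= C * (1 + `|y|).
Proof.
move=> [L HL]; exists (enorm (grad g 0) + `|L| * n%:R).
  by rewrite addr_ge0 ?enorm_ge0 ?mulr_ge0.
move=> i y.
have gE w : pd i g w = grad g w ord0 i by rewrite mxE.
rewrite -[pd i g y](subrK (pd i g 0)) (le_trans (ler_normD _ _))//.
have h1 : `|pd i g 0| <= enorm (grad g 0) by rewrite gE ler_coord_enorm.
have h2 : `|pd i g y - pd i g 0| <= `|L| * n%:R * `|y|.
  apply: (@le_trans _ _ (enorm (grad g y - grad g 0))).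
    rewrite [pd i g y - _](_ : _ = (grad g y - grad g 0) ord0 i) ?ler_coord_enorm//.
    by rewrite !mxE.
  apply: le_trans (HL _ _) _; rewrite subr0 -mulrA.
  apply: (@le_trans _ _ (`|L| * enorm y)).
    by rewrite ler_wpM2r ?enorm_ge0// ler_norm.
  by rewrite ler_wpM2l// ler_enorm_norm.
have := enorm_ge0 (grad g 0); have := normr_ge0 y.
have : 0 <= `|L| * n%:R by rewrite mulr_ge0.
by move: h1 h2; nra.
Qed.

(** Three cases by order of differentiation: a Lipschitz gradient grows at most linearly, so [g]
    grows at most quadratically by the mean value estimate, and derivatives of order at least two
    are bounded by assumption. *)
Lemma smooth_lipschitz_quadratic_growth g :
  smooth g -> lipschitz_field (grad g) -> 
  (forall j, (2 <= j)%N -> exists C : R, forall x, nabla_norm j g x <= C) ->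
  forall s, quadratic_growth (pds s g).
Proof.
move=> sg lg bg; have [C C0 HC] := lipschitz_pd_growth lg.
have le1 (y : 'rV[R]_n) : `|y| <= 1 + dot y y.
  have := ler_sqr_norm_dot y; have := sqr_ge0 (`|y| - 1); nra.
have dge0 (y : 'rV[R]_n) := dot_ge0 y.
move=> [|i [|j s]].
- exists (`|g 0| + n%:R * C * 2); first by rewrite addr_ge0 ?mulr_ge0.
  move=> y /=.
  have h : `|g y - g 0| <= n%:R * (C * (1 + `|y|)) * `|y - 0|.
    apply: mean_value_coord => [i w|i w]; first exact: smooth_derivable.
    rewrite !subr0 => wy; apply: le_trans (HC _ _) _.
    by rewrite ler_wpM2l// lerD2l.
  have E : n%:R * (C * (1 + `|y|)) * `|y - 0| <= n%:R * C * 2 * (1 + dot y y).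
    rewrite subr0 !mulrA -!(mulrA (n%:R * C)) ler_wpM2l ?mulr_ge0//.
    have := ler_sqr_norm_dot y; have := le1 y; nra.
  rewrite -[g y](subrK (g 0)) (le_trans (ler_normD _ _))//.
  have := le_trans h E; have := dge0 y; have := normr_ge0 (g 0); nra.
- exists (C * 2); first by rewrite mulr_ge0.
  move=> y /=; apply: le_trans (HC _ _) _; rewrite -mulrA ler_wpM2l//.
  by have := le1 y; have := dge0 y; nra.
- have [D HD] := bg (size [:: i, j & s]) isT.
  exists `|D| => // y; set t := [:: i, j & s].
  apply: (@le_trans _ _ `|D|); last first.
    by rewrite ler_peMr// lerDl.
  apply: le_trans (ler_norm _); apply: le_trans (HD y).
  (* The chosen partial derivative is one of the entries whose squares are summed in
     [nabla_norm]. *)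
  rewrite -sqrtr_sqr ler_wsqrtr// (bigD1 (in_tuple t))//= lerDl.
  by apply: sumr_ge0 => u _; rewrite sqr_ge0.
Qed.

End growth.

(** * Integration on row vectors *)

Section measure_rV.
Context {R : realType}.
Implicit Types (n : nat).

(** The open sup-norm ball in coordinates, a form from which measurability and volume can be read
    off one coordinate at a time. *)
Definition cube n (x : 'rV[R]_n) (r : R) : set 'rV[R]_n :=
  [set y | forall i, `|x ord0 i - y ord0 i| < r].

Lemma cube_ball n (x : 'rV[R]_n) r : 0 < r -> cube x r = ball x r.
Proof.
move=> r0; apply/seteqP; split => y /=.
  by move=> H; split => // i j; rewrite (ord1 i); exact: H.
by move=> [_ H] i; exact: H.
Qed.

Lemma measurable_cube n (x : 'rV[R]_n) r : measurable (cube x r).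
Proof.
rewrite (_ : cube x r = \bigcap_(i in [set: 'I_n])
    ((fun y : 'rV[R]_n => y ord0 i) @^-1` [set t | `|x ord0 i - t| < r])).
  apply: fin_bigcap_measurable => // i _.
  rewrite -[X in measurable X]setTI.
  apply: (measurable_rV_coord i measurableT).
  rewrite (_ : [set _ | _] = [set` `](x ord0 i - r), (x ord0 i + r)[%R]).
    exact: measurable_itv.
  by apply/seteqP; split => t; rewrite /= in_itv/= -ltr_distl distrC.
by apply/seteqP; split => y /= H i => [_|]; exact: H.
Qed.

(** An open set is the countable union of the cubes with rational centre and radius [1 / (k + 1)]
    that it contains, so the sigma-algebra generated by the coordinates contains the open sets. *)
Lemma open_measurable_rV n (A : set 'rV[R]_n) : open A -> measurable A.
Proof.
move=> oA.
pose Q (pk : 'rV[rat]_n * nat) := cube (map_mx (@ratr R) pk.1) pk.2.+1%:R^-1.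
pose F pk := if `[< Q pk `<=` A >] then Q pk else set0.
rewrite (_ : A = \bigcup_pk F pk).
  apply: countable_bigcupT_measurable; first exact: countableP.
  by move=> pk; rewrite /F; case: ifP => // _; exact: measurable_cube.
apply/seteqP; split; last first.
  by move=> y [pk _]; rewrite /F; case: asboolP => // H; exact: H.
move=> x Ax.
have /nbhs_ballP[/= e e0 He] : nbhs x A by exact: open_nbhs_nbhs.
(* With this [k], a cube of radius [1 / (k + 1)] whose centre is that close to [x] contains [x] and
   lies within [2 / (k + 1) < e] of it. *)
pose k := Num.truncn (2 / e).
have ke : 2 * k.+1%:R^-1 < e.
  by rewrite -ltr_pdivlMr ?invr_gt0// invrK mulrC -ltr_pdivrMr// truncnS_gt.
have k0 : 0 < k.+1%:R^-1 :> R by rewrite invr_gt0.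
have H i : exists q : rat, `|ratr q - x ord0 i| < k.+1%:R^-1.
  have [q] := @rat_in_itvoo R (x ord0 i - k.+1%:R^-1) (x ord0 i + k.+1%:R^-1)
    ltac:(by rewrite ltrD2l gtrN).
  by rewrite in_itv/= => Hq; exists q; rewrite ltr_distl.
(* A rational centre, chosen coordinatewise; by [H] the default 0 of [xget] is never taken. *)
pose p : 'rV[rat]_n := \row_i xget 0 [set q | `|ratr q - x ord0 i| < k.+1%:R^-1].
have Hp i : `|ratr (p ord0 i) - x ord0 i| < k.+1%:R^-1.
  rewrite mxE; case: xgetP => [q -> //|].
  by case: (H i) => q Hq /(_ q).
exists (p, k) => //; rewrite /F; case: asboolP => [_ i|]; first by rewrite mxE.
case=> y Hy; apply: He; rewrite -cube_ball// => i.
rewrite (le_lt_trans _ ke)//.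
have := Hy i; rewrite /= mxE; have := Hp i; rewrite distrC.
have := ler_distD (ratr (p ord0 i)) (x ord0 i) (y ord0 i).
by move: (k.+1%:R^-1) => c; lra.
Qed.

Lemma continuous_measurable_rV n (g : 'rV[R]_n -> R) :
  continuous g -> measurable_fun setT g.
Proof.
move=> /continuousP cg mD; apply: (measurability _ (RGenOpens.measurableE R)) => //.
move=> _ [_ [a [b ->] <-]]; rewrite setTI.
by apply: open_measurable_rV; exact/cg/interval_open.
Qed.

(** Induction on the dimension: [consrV] pulls a cube back to the product of an interval of length
    [2 r] and a cube of one dimension less. Finiteness yields integrability on bounded sets,
    positivity the vanishing result below. *)
Lemma leb_cube n (x : 'rV[R]_n) r : 0 < r ->
  exists2 M : R, 0 < M & leb n (cube x r) = M%:E.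
Proof.
move=> r0; elim: n x => [x|n ih x].
  exists 1 => //=; rewrite diracE mem_set//.
  by case.
have [M M0 HM] := ih (rsubmx (x : 'rV_(1 + n))).
exists (2 * r * M); first by rewrite !mulr_gt0.
have E : @consrV R n @^-1` cube x r =
    ([set` `](x ord0 ord0 - r), (x ord0 ord0 + r)[] : set R) `*`
    cube (rsubmx (x : 'rV_(1 + n))) r.
  have l0 : lshift n (ord0 : 'I_1) = ord0 by exact: val_inj.
  apply/seteqP; split => -[a v] /=.
    move=> H; split.
      have := H (lshift n (ord0 : 'I_1)); rewrite [consrV _ _ _]row_mxEl mxE eqxx mulr1n.
      by rewrite l0 in_itv/= distrC ltr_distl.
    move=> i; have := H (rshift 1 i); rewrite [consrV _ _ _]row_mxEr /=.
    by rewrite mxE.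
  rewrite in_itv/= -ltr_distl distrC => -[Ha Hv] i.
  case: (split_ordP (i : 'I_(1 + n))) => j ->.
    rewrite [consrV _ _ _]row_mxEl mxE (ord1 j) eqxx mulr1n.
    by rewrite l0.
  by rewrite [consrV _ _ _]row_mxEr; have := Hv j; rewrite mxE.
have := @lebesgue_measure_itv R `](x ord0 ord0 - r), (x ord0 ord0 + r)[.
rewrite /= lte_fin ltrD2l gtrN// => L.
rewrite /cons_measure /pushforward E product_measure1E//; last exact: measurable_cube.
rewrite HM; rewrite [X in (X * _)%E](_ : _ = (2 * r)%:E) -?EFinM//.
by apply: etrans L _; rewrite -EFinB; congr EFin; ring.
Qed.

Lemma integrable_indic_cube n (x : 'rV[R]_n) r : 0 < r ->
  (leb n).-integrable setT (fun z => (\1_(cube x r) z)%:E).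
Proof.
move=> r0; have mc := measurable_cube x r; apply/integrableP; split.
  by apply/measurable_EFinP; exact: measurable_indic.
under eq_integral do rewrite gee0_abs ?lee_fin//.
have [c _ Hc] := leb_cube x r0.
by rewrite integral_indic// setIT [X in (X < _)%E]Hc ltry.
Qed.

(** The radius [|M| + 1] is positive for every [M] and leaves room for the strict inequality in
    [cube]. *)
Lemma bounded_enorm_cube n (M : R) : [set z : 'rV[R]_n | enorm z <= M] `<=`
  cube 0 (`|M| + 1).
Proof.
move=> z /= zM i; rewrite mxE sub0r normrN.
rewrite (le_lt_trans (ler_coord_enorm z i))// (le_lt_trans zM)//.
by rewrite (le_lt_trans (ler_norm _))// ltrDl.
Qed.

Lemma continuous_bounded_cube n (g : 'rV[R]_n -> R) r : continuous g -> 
  exists B : R, forall z, cube 0 r z -> `|g z| <= B.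
Proof.
move=> cg.
have cn : continuous (fun z => `|g z|).
  by move=> z; apply: continuous_comp; [exact: cg|exact: norm_continuous].
have cK : compact [set z : 'rV[R]_n | forall i, `[- r, r]%classic (z ord0 i)].
  by apply: (@rV_compact _ _ (fun=> `[- r, r]%classic)) => i; exact: segment_compact.
(* The extreme value theorem on the closed box asks for a point; when the cube is empty the claim is
   vacuous. *)
have [[z0 Hz0]|noz] := pselect (exists z : 'rV[R]_n, cube 0 r z); last first.
  by exists 0 => z Hz; exfalso; apply: noz; exists z.
have sub z : cube 0 r z ->
    [set z : 'rV[R]_n | forall i, `[- r, r]%classic (z ord0 i)] z.
  move=> Hz i; rewrite /= in_itv/= -ler_norml.
  by have := Hz i; rewrite mxE sub0r normrN => /ltW.
have [c _ Hc] := @EVT_max_rV R n (fun z => `|g z|) _ (ex_intro _ z0 (sub _ Hz0)) cK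
  (continuous_subspaceT cn).
exists `|g c| => z Hz; apply: Hc; rewrite inE; exact: sub.
Qed.

(** Phrased as the second clause of [admissible], so that the two can be exchanged without
    conversion. *)
Definition compact_support n (g : 'rV[R]_n -> R) :=
  exists M : R, forall z, M < enorm z -> g z = 0.

Lemma integrable_compact_support n (g : 'rV[R]_n -> R) :
  continuous g -> compact_support g -> (leb n).-integrable setT (EFin \o g).
Proof.
move=> cg [M HM].
have [B HB] := continuous_bounded_cube (`|M| + 1) cg.
have r0 : 0 < `|M| + 1 by rewrite ltr_wpDl.
have ind : (leb n).-integrable setT
    (fun z => (B%:E * (\1_(cube 0 (`|M| + 1)) z)%:E)%E).
  by apply: integrableZl => //; exact: integrable_indic_cube.
apply: le_integrable ind => //.
  by apply/measurable_EFinP; exact: continuous_measurable_rV.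
move=> z _; rewrite -EFinM /= lee_fin.
have [zM|zM] := leP (enorm z) M.
  have zc : cube 0 (`|M| + 1) z by exact: bounded_enorm_cube.
  by rewrite indicE mem_set// mulr1 (le_trans (HB _ zc))// ler_norm.
by rewrite HM// normr0.
Qed.

(** If [g z > 0], then [g] exceeds [g z / 2] on a cube around [z], which has positive measure, and
    the integral would be positive. *)
Lemma continuous_Rintegral0_eq0 n (g : 'rV[R]_n -> R) :
  continuous g -> (forall z, 0 <= g z) -> (leb n).-integrable setT (EFin \o g) ->
  \int[leb n]_z g z = 0 -> forall z, g z = 0.
Proof.
move=> cg g0 ig Ig z; apply/eqP; rewrite eq_le g0 andbT leNgt; apply/negP => gz.
have : \forall y \near z, g z / 2 < g y.
  by apply: (cvgr_gt _ (cg z)); rewrite ltr_pdivrMr// ltr_pMr// ltr1n.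
move=> /nbhs_ballP[/= r r0 Hr].
have [c c0 Hc] := leb_cube z r0.
have : \int[leb n]_y (g z / 2 * \1_(cube z r) y) <= \int[leb n]_y g y.
  apply: le_Rintegral => //.
    apply: (@integrableZl _ _ _ (leb n) setT measurableT (g z / 2)
      (fun y => (\1_(cube z r) y)%:E)) => //; exact: integrable_indic_cube.
  move=> y _; rewrite indicE; case: (boolP (y \in cube z r)) => [|_].
    rewrite inE cube_ball// => /Hr/ltW; by rewrite mulr1.
  by rewrite mulr0.
rewrite Ig /Rintegral.
under eq_integral do rewrite EFinM.
rewrite ge0_integralZl//; last 2 first.
- by apply/measurable_EFinP; exact: measurable_indic (measurable_cube _ _).
- by rewrite lee_fin divr_ge0// ltW.
rewrite integral_indic ?setIT//; last exact: measurable_cube.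
rewrite [X in (_ * X)%E]Hc.
by rewrite -EFinM /= leNgt mulr_gt0// divr_gt0.
Qed.

End measure_rV.

(** * Integration against a measure given by a density *)

Section density_change.
Context d {T : measurableType d} {R : realType}.
Variables (mu nu : {measure set T -> \bar R}) (f : T -> R).
Hypotheses (mf : measurable_fun setT f) (f0 : forall z, 0 <= f z).
Hypothesis nuE : forall A, measurable A -> nu A = (\int[mu]_(z in A) (f z)%:E)%E.
Import HBNNSimple.

(** The standard extension: [nuE] is the case of indicators, finite sums give simple functions, and
    monotone convergence on both sides gives nonnegative measurable functions. *)
Lemma ge0_integral_density (g : T -> \bar R) :
  measurable_fun setT g -> (forall z, 0 <= g z)%E ->
  (\int[nu]_z g z = \int[mu]_z (g z * (f z)%:E))%E.
Proof.
move=> mg g0; pose h := nnsfun_approx measurableT mg.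
have gE z : g z = lim ((EFin \o h k) z @[k --> \oo]).
  by apply/esym/cvg_lim => //; exact: cvg_nnsfun_approx.
have nd z : {homo (fun k => (h k z)%:E) : a b / (a <= b)%N >-> (a <= b)%E}.
  by move=> a b ab; rewrite lee_fin; exact/lefP/nd_nnsfun_approx.
transitivity (lim ((\int[nu]_z (EFin \o h k) z)%E @[k --> \oo])).
  under eq_integral do rewrite gE.
  apply: monotone_convergence => //.
  - by move=> k; apply/measurable_EFinP; exact/measurable_funP.
  - by move=> k z _ /=; rewrite lee_fin.
  - by move=> z _; exact: nd.
transitivity (lim ((\int[mu]_z ((EFin \o h k) z * (f z)%:E))%E @[k --> \oo])); last first.
  rewrite -monotone_convergence//; last 3 first.
  - move=> k; apply: emeasurable_funM; apply/measurable_EFinP => //.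
  - by move=> k z _; rewrite mule_ge0 ?lee_fin.
  - by move=> z _ a b ab; rewrite lee_wpmul2r ?lee_fin//; exact/lefP/nd_nnsfun_approx.
  apply: eq_integral => z _; rewrite gE; apply/cvg_lim => //.
  by apply: cvgeZr => //; rewrite -gE; exact: cvg_nnsfun_approx.
congr (lim (_ @ \oo)); apply/funext => k /=.
transitivity (\int[nu]_z
   (\sum_(y \in range (h k)) (y * \1_(h k @^-1` [set y]) z)%:E))%E.
  by apply: eq_integral => z _; rewrite /= fimfunE -fsumEFin.
rewrite ge0_integral_fsum//; last 2 first.
- by move=> y; apply/measurable_EFinP; exact: measurable_funM.
- by move=> m y _; exact: nnfun_muleindic_ge0.
transitivity (\int[mu]_z (\sum_(y \in range (h k))
    (y * \1_(h k @^-1` [set y]) z)%:E * (f z)%:E))%E; last first.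
  apply: eq_integral => z _.
  rewrite -ge0_mule_fsuml => [|y]; last exact: nnfun_muleindic_ge0.
  by rewrite fsumEFin // -(fimfunE _ z).
rewrite ge0_integral_fsum//; last 2 first.
- move=> y; apply: emeasurable_funM; apply/measurable_EFinP => //.
  exact: measurable_funM.
- move=> m y _; apply: mule_ge0; first exact: nnfun_muleindic_ge0.
  by rewrite lee_fin.
apply: eq_fsbigr => r rhn.
under eq_integral do rewrite EFinM.
rewrite integralZl_indic_nnsfun//.
under [RHS]eq_integral do rewrite EFinM -muleA.
rewrite ge0_integralZl//; last 3 first.
- by apply: emeasurable_funM; apply/measurable_EFinP.
- by move=> z _; rewrite mule_ge0 ?lee_fin.
- by move: rhn; rewrite inE => -[z _ <-]; rewrite lee_fin.
congr (_ * _)%E; rewrite integral_indic// setIT nuE// integral_mkcond.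
apply: eq_integral => z _; rewrite /patch indicE.
by case: (z \in _); rewrite ?mul1e ?mul0e.
Qed.

End density_change.

(** * Integrable real-valued functions *)

Section real_integrable.
Context dT {T : measurableType dT} {R : realType} (mu : {measure set T -> \bar R}).
Implicit Types f g : T -> R.

Lemma integrableZ_EFin (c : R) f : mu.-integrable setT (fun z => (f z)%:E) ->
  mu.-integrable setT (fun z => (c * f z)%:E).
Proof. by move=> fi; exact: (integrableZl measurableT c fi). Qed.

Lemma integrableD_EFin f g : mu.-integrable setT (fun z => (f z)%:E) ->
  mu.-integrable setT (fun z => (g z)%:E) ->
  mu.-integrable setT (fun z => (f z + g z)%:E).
Proof. by move=> fi gi; exact: (integrableD measurableT fi gi). Qed.

Lemma integrableB_EFin f g : mu.-integrable setT (fun z => (f z)%:E) ->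
  mu.-integrable setT (fun z => (g z)%:E) ->
  mu.-integrable setT (fun z => (f z - g z)%:E).
Proof. by move=> fi gi; exact: (integrableB measurableT fi gi). Qed.

Lemma eq_integrable_EFin f g : f =1 g -> mu.-integrable setT (fun z => (f z)%:E) ->
  mu.-integrable setT (fun z => (g z)%:E).
Proof. by move=> /funext ->. Qed.

Lemma le_integrable_EFin f g : measurable_fun setT f ->
  (forall z, `|f z| <= g z) -> mu.-integrable setT (fun z => (g z)%:E) ->
  mu.-integrable setT (fun z => (f z)%:E).
Proof.
move=> mf fg; apply: le_integrable => //; first exact/measurable_EFinP.
by move=> z _; rewrite lee_fin (le_trans (fg z))// ler_norm.
Qed.

Lemma integrable_norm_EFin f : mu.-integrable setT (fun z => (f z)%:E) ->
  mu.-integrable setT (fun z => `|f z|%:E).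
Proof. by move=> fi; exact: (@integrable_norm _ _ _ mu setT f fi). Qed.

Lemma integrable_measurable_EFin f : mu.-integrable setT (fun z => (f z)%:E) ->
  measurable_fun setT f.
Proof. by move=> /measurable_int/measurable_EFinP. Qed.

(** Gathers a first-order remainder of integrals under one integral, in the shape asked for by
    [is_derive_quadratic]. *)
Lemma Rintegral_increment f1 f2 f3 c :
  mu.-integrable setT (fun z => (f1 z)%:E) ->
  mu.-integrable setT (fun z => (f2 z)%:E) ->
  mu.-integrable setT (fun z => (f3 z)%:E) ->
  \int[mu]_z f1 z - \int[mu]_z f2 z - c * \int[mu]_z f3 z =
  \int[mu]_z (f1 z - f2 z - c * f3 z).
Proof.
move=> i1 i2 i3; rewrite RintegralB//; last 2 first.
- exact: integrableB_EFin.
- exact: integrableZ_EFin.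
by rewrite RintegralB// RintegralZl.
Qed.

End real_integrable.

(** * Convolution *)

Section convolution.
Context {R : realType} {d : nat}.
Implicit Types (k : 'rV[R]_d -> R) (g w : 'rV[R]_(d + d) -> R).
Implicit Types (x : 'rV[R]_d) (z : 'rV[R]_(d + d)).
Local Notation mu := (leb (d + d)).

(* signed weights are allowed, to cover both densities and perturbations *)
Definition second_moment w : Prop := measurable_fun setT w /\
  mu.-integrable setT (fun z => ((1 + dot z z) * w z)%:E).

Definition second_moment_mass w : R := \int[mu]_z ((1 + dot z z) * `|w z|).

Lemma dot1_gt0 n (y : 'rV[R]_n) : 0 < 1 + dot y y.
Proof. by rewrite ltr_wpDr// dot_ge0. Qed.

Lemma second_moment_abs w : second_moment w ->
  mu.-integrable setT (fun z => ((1 + dot z z) * `|w z|)%:E).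
Proof.
move=> [mw iw]; apply: eq_integrable_EFin (integrable_norm_EFin iw) => z.
by rewrite normrM gtr0_norm// dot1_gt0.
Qed.

Lemma second_moment_mass_ge0 w : 0 <= second_moment_mass w.
Proof.
by apply: Rintegral_ge0 => z _; rewrite mulr_ge0// ltW// dot1_gt0.
Qed.

Lemma integrable_second_moment g w : measurable_fun setT g ->
  quadratic_growth g -> second_moment w ->
  mu.-integrable setT (fun z => (g z * w z)%:E).
Proof.
move=> mg [C C0 HC] mw; have [mw' _] := mw.
have iw := integrableZ_EFin C (second_moment_abs mw).
apply: le_integrable_EFin iw; first exact: measurable_funM.
by move=> z; rewrite normrM mulrA ler_wpM2r.
Qed.

Lemma le_Rintegral_second_moment g w C : measurable_fun setT g ->
  (forall z, `|g z| <= C * (1 + dot z z)) -> second_moment w ->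
  `|\int[mu]_z (g z * w z)| <= C * second_moment_mass w.
Proof.
move=> mg HC mw.
have C0 : 0 <= C.
  by have := le_trans (normr_ge0 _) (HC 0); rewrite pmulr_lge0// dot1_gt0.
have ig : mu.-integrable setT (fun z => (g z * w z)%:E).
  by apply: integrable_second_moment => //; exists C.
apply: le_trans (le_normr_Rintegral measurableT ig) _.
rewrite -RintegralZl//; last exact: second_moment_abs.
apply: le_Rintegral => //.
- exact: integrable_norm_EFin ig.
- exact/integrableZ_EFin/second_moment_abs.
- by move=> z _; rewrite normrM mulrA ler_wpM2r.
Qed.

Lemma measurable_shift_pos k x : continuous k ->
  measurable_fun setT (fun z => k (x - pos z)).
Proof.
move=> ck; apply: continuous_measurable_rV => z.
apply: (@continuous_comp _ _ _ (fun z => x - pos z) k z _ (ck _)).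
apply: (@continuousB _ _ _ (fun=> x) (@pos R d) z); first exact: cst_continuous.
exact: continuous_pos.
Qed.

(** By [|x - y|^2 <= 2 |x|^2 + 2 |y|^2], the bound separates into a factor in [x] and a factor in
    [z]; the latter is integrated against the weight. *)
Lemma shift_growth k C x z : 0 <= C ->
  (forall y, `|k y| <= C * (1 + dot y y)) ->
  `|k (x - pos z)| <= C * 2 * (1 + dot x x) * (1 + dot z z).
Proof.
move=> C0 HC; apply: le_trans (HC _) _; rewrite -!mulrA ler_wpM2l//.
have := ler_dotB x (pos z); have := ler_dot_pos z.
have := dot_ge0 x; have := dot_ge0 z.
move: (dot x x) (dot z z) (dot (pos z) (pos z)) (dot _ _) => a b c e.
by nra.
Qed.

Lemma integrable_conv k w x : continuous k -> quadratic_growth k ->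
  second_moment w -> mu.-integrable setT (fun z => (k (x - pos z) * w z)%:E).
Proof.
move=> ck [C C0 HC] mw; apply: integrable_second_moment => //.
  exact: measurable_shift_pos.
exists (C * 2 * (1 + dot x x)) => [|z]; last exact: shift_growth.
by rewrite !mulr_ge0// ltW// dot1_gt0.
Qed.

Lemma conv_growth k w : continuous k -> quadratic_growth k ->
  second_moment w -> quadratic_growth (conv k w).
Proof.
move=> ck [C C0 HC] mw; exists (C * 2 * second_moment_mass w) => [|x].
  by rewrite !mulr_ge0// second_moment_mass_ge0.
rewrite mulrAC; apply: le_Rintegral_second_moment => // [|z].
  exact: measurable_shift_pos.
exact: shift_growth.
Qed.

Lemma conv_perturb k f (eps : R) w x : continuous k -> quadratic_growth k ->
  second_moment f -> second_moment w ->
  conv k (perturb f eps w) x = conv k f x + eps * conv k w x.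
Proof.
move=> ck gk mf mw; have iw := integrable_conv x ck gk mw.
rewrite /conv -RintegralZl// -RintegralD//.
- by apply: eq_Rintegral => z _; rewrite /perturb; ring.
- exact: integrable_conv.
- exact: integrableZ_EFin.
Qed.

(** The pointwise Taylor remainder of [k] is at most [h^2] times a multiple of [1 + |z|^2],
    uniformly for [|h| < 1]. Integrating it against [w] leaves a quadratic remainder for the
    convolution. *)
Lemma is_derive_conv k w x i : smooth k -> (forall s, quadratic_growth (pds s k)) ->
  second_moment w ->
  is_derive x (delta_mx ord0 i) (conv k w) (conv (pd i k) w x).
Proof.
move=> sk gk mw; pose e : 'rV[R]_d := delta_mx ord0 i.
have dk y : derivable k y e by exact: smooth_derivable.
have sdk := smooth_pd i sk.
have ddk y : derivable (pd i k) y e by exact: smooth_derivable.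
have [C C0 HC] := gk [:: i; i].
have ik y : mu.-integrable setT (fun z => (k (y - pos z) * w z)%:E).
  by apply: integrable_conv => //; [exact: smooth_continuous|exact: gk [::]].
have idk : mu.-integrable setT (fun z => (pd i k (x - pos z) * w z)%:E).
  by apply: integrable_conv => //; [exact: smooth_continuous|exact: gk [:: i]].
(* [C * 2] comes from [shift_growth], and [3 + 2 |x|^2] bounds [1 + |x + s e|^2] for [|s| <= 1]. *)
pose M := C * 2 * (3 + 2 * dot x x).
apply: (@is_derive_quadratic _ _ _ _ _ _ (M * second_moment_mass w) 1) => // h h1.
have dee : dot e e = 1.
  rewrite /dot (bigD1 i)//= !mxE !eqxx mulr1 big1 ?addr0// => j ji.
  by rewrite !mxE (negbTE ji) mulr0.
have T z : `|k (x + h *: e - pos z) - k (x - pos z) - h * pd i k (x - pos z)|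
    <= M * h ^+ 2 * (1 + dot z z).
  rewrite (addrAC x) mulrAC; apply: taylor_line => // s sh.
  rewrite (addrAC x); apply: le_trans (shift_growth _ _ C0 HC) _.
  rewrite ler_wpM2r ?(ltW (dot1_gt0 _))// ler_wpM2l ?mulr_ge0//.
  have -> : x + s *: e = x - (- s *: e) by rewrite scaleNr opprK.
  have := ler_dotB x (- s *: e).
  have -> : dot (- s *: e) (- s *: e) = s ^+ 2 * dot e e.
    by rewrite /dot mulr_sumr; apply: eq_bigr => j _; rewrite !mxE; ring.
  have : s ^+ 2 <= 1.
    by rewrite -real_normK ?num_real// expr_le1// (le_trans sh)// ltW.
  by rewrite dee; lra.
rewrite /conv Rintegral_increment//.
rewrite [X in `|X|](_ : _ = \int[mu]_z ((k (x + h *: e - pos z) - k (x - pos z)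
                        - h * pd i k (x - pos z)) * w z)); last first.
  by apply: eq_Rintegral => z _; ring.
rewrite mulrAC; apply: le_Rintegral_second_moment => //.
apply: measurable_funB; first apply: measurable_funB.
- by apply: measurable_shift_pos; exact: smooth_continuous.
- by apply: measurable_shift_pos; exact: smooth_continuous.
- apply: measurable_funM => //.
  by apply: measurable_shift_pos; exact: smooth_continuous.
Qed.

(** Derivatives fall on the kernel, so the convolutions of [w] with kernels of this kind are stable
    under [pd]; [w] itself is merely measurable with a second moment. *)
Lemma smooth_conv k w : smooth k -> (forall s, quadratic_growth (pds s k)) ->
  second_moment w -> smooth (conv k w).
Proof.
move=> sk gk mw; pose S (g : 'rV[R]_d -> R) := exists k, [/\ smooth k,
  forall s, quadratic_growth (pds s k) & g = conv k w].
suff HS (g : 'rV[R]_d -> R) : S g -> smooth g by apply: HS; exists k.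
apply: smooth_coind => {g}.
move=> _ [{sk gk}k [sk gk ->]].
have D i x := is_derive_conv x i sk gk mw.
have dc i x : derivable (conv k w) x (delta_mx ord0 i) by have [] := D i x.
have pdE i : pd i (conv k w) = conv (pd i k) w.
  by apply/funext => x; rewrite /pd; have [] := D i x.
split; last first.
  move=> i; split; first exact: dc.
  exists (pd i k); split => //; first exact: smooth_pd.
  by move=> s; have := gk (rcons s i); rewrite /pds foldr_rcons.
apply: continuous_bounded_pd => // x.
have /choice[C HC] i : exists C, 0 <= C /\
    forall y, `|conv (pd i k) w y| <= C * (1 + dot y y).
  have [C C0 HC] : quadratic_growth (conv (pd i k) w); last by exists C.
  by apply: conv_growth => //; [exact/smooth_continuous/smooth_pd|exact: gk [:: i]].
(* The sum dominates each [C i]. For [|y - x| <= 1] in the sup norm, [|y|^2] is at most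
   [2 |x|^2 + 2 d^2] in the Euclidean norm, as the two norms differ by at most the factor [d]. *)
exists ((\sum_i C i) * (1 + 2 * dot x x + 2 * d%:R ^+ 2)) => i y yx.
rewrite pdE; have [_ H] := HC i; apply: le_trans (H y) _.
apply: ler_pM.
- by have [] := HC i.
- exact/ltW/dot1_gt0.
- rewrite (bigD1 i)//= lerDl sumr_ge0// => j _.
  by have [] := HC j.
- rewrite -{1 2}(subKr x y) -addrA lerD2l.
  apply: le_trans (ler_dotB _ _) _; rewrite lerD2l ler_wpM2l//.
  rewrite -sqr_enorm lerXn2r ?nnegrE ?enorm_ge0//.
  apply: le_trans (ler_enorm_norm _) _.
  by rewrite ler_piMr// distrC.
Qed.

Lemma measurable_sub_pos k : continuous k ->
  measurable_fun setT (fun p : 'rV[R]_(d + d) * 'rV[R]_(d + d) =>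
    k (pos p.1 - pos p.2)).
Proof.
move=> ck; apply: (@measurableT_comp _ _ _ _ _ _ k _
  (fun p : 'rV[R]_(d + d) * 'rV[R]_(d + d) => pos p.1 - pos p.2)).
  exact: continuous_measurable_rV.
apply: measurable_fun_rVP => i.
under eq_fun do rewrite !mxE.
apply: measurable_funB.
  exact: (measurableT_comp (measurable_rV_coord _) measurable_fst).
exact: (measurableT_comp (measurable_rV_coord _) measurable_snd).
Qed.

(** Fubini for [w1(z) k(x - x') w2(z')]; the evenness of [k] restores the order of the two positions
    after the exchange. *)
Lemma conv_sym k w1 w2 : continuous k -> quadratic_growth k ->
  (forall x, k (- x) = k x) -> second_moment w1 -> second_moment w2 ->
  \int[mu]_z (w1 z * conv k w2 (pos z)) = \int[mu]_z (w2 z * conv k w1 (pos z)).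
Proof.
move=> ck gk ek mw1 mw2; have [C C0 HC] := gk.
have [meas1 _] := mw1; have [meas2 _] := mw2.
pose F (p : 'rV[R]_(d + d) * 'rV[R]_(d + d)) : R :=
  w1 p.1 * (k (pos p.1 - pos p.2) * w2 p.2).
(* A majorant of [|F|] that is a product of a function of each variable, both integrable by the
   second moments. *)
pose H (p : 'rV[R]_(d + d) * 'rV[R]_(d + d)) : R :=
  (C * 2 * ((1 + dot p.1 p.1) * `|w1 p.1|)) * ((1 + dot p.2 p.2) * `|w2 p.2|).
have mF : measurable_fun setT F.
  apply: measurable_funM.
    exact: (measurableT_comp meas1 measurable_fst).
  apply: measurable_funM; first exact: measurable_sub_pos.
  exact: (measurableT_comp meas2 measurable_snd).
have i1 := second_moment_abs mw1; have i2 := second_moment_abs mw2.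
have m1 := measurable_int mu i1; have m2 := measurable_int mu i2.
have mH : measurable_fun setT H.
  apply: measurable_funM.
    apply: measurable_funM => //.
    by move/measurable_EFinP : m1 => m1; exact: (measurableT_comp m1 measurable_fst).
  by move/measurable_EFinP : m2 => m2; exact: (measurableT_comp m2 measurable_snd).
have H1ge0 z : 0 <= C * 2 * ((1 + dot z z) * `|w1 z|).
  by rewrite !mulr_ge0// ltW// dot1_gt0.
have H2ge0 z : 0 <= (1 + dot z z) * `|w2 z|.
  by rewrite !mulr_ge0// ltW// dot1_gt0.
have iH : (mu \x mu)%E.-integrable setT (EFin \o H).
  apply/integrable12ltyP; first exact/measurable_EFinP.
  have := integrableZ_EFin (C * 2 * second_moment_mass w2) i1.
  move=> /integrableP[_]; congr (_ < _)%E; apply: eq_integral => z _.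
  transitivity ((C * 2 * ((1 + dot z z) * `|w1 z|))%:E *
     \int[mu]_z' ((1 + dot z' z') * `|w2 z'|)%:E)%E; last first.
    rewrite -ge0_integralZl//.
    - by apply: eq_integral => z' _; rewrite gee0_abs /= ?EFinM// lee_fin mulr_ge0.
    - by move=> z' _; rewrite lee_fin.
    - by rewrite lee_fin.
  rewrite -(fineK (integrable_fin_num measurableT i2)) -EFinM.
  rewrite gee0_abs; last by rewrite lee_fin !mulr_ge0 ?second_moment_mass_ge0 ?(ltW (dot1_gt0 _)).
  congr EFin; rewrite /second_moment_mass /Rintegral; ring.
have iF : (mu \x mu)%E.-integrable setT (EFin \o F).
  apply: le_integrable_EFin iH => // p; rewrite /F /H !normrM.
  rewrite [leLHS](_ : _ = `|k (pos p.1 - pos p.2)| *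
    (`|w1 p.1| * `|w2 p.2|)); last by ring.
  rewrite [leRHS](_ : _ = C * 2 * (1 + dot p.1 p.1) * (1 + dot p.2 p.2) *
    (`|w1 p.1| * `|w2 p.2|)); last by ring.
  rewrite ler_wpM2r ?mulr_ge0//; apply: le_trans (shift_growth _ _ C0 HC) _.
  rewrite ler_wpM2r ?(ltW (dot1_gt0 _))// ler_wpM2l ?mulr_ge0//.
  by rewrite lerD2l ler_dot_pos.
have I w x : second_moment w ->
    (\int[mu]_z' (k (x - pos z') * w z')%:E)%E = (conv k w x)%:E.
  move=> mw; rewrite /conv /Rintegral fineK//.
  by apply: integrable_fin_num => //; exact: integrable_conv.
rewrite /Rintegral; congr fine.
transitivity (\int[mu]_z \int[mu]_z' (F (z, z'))%:E)%E.
  apply: eq_integral => z _; rewrite EFinM -I//.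
  by rewrite -integralZl//; exact: integrable_conv.
rewrite (@Fubini _ _ _ _ _ mu mu (EFin \o F) iF).
apply: eq_integral => z _; rewrite EFinM -I// -integralZl//; last exact: integrable_conv.
apply: eq_integral => z' _; rewrite /= /F /= -EFinM; congr EFin.
by rewrite -ek opprB; ring.
Qed.

End convolution.

(** * First variations *)

Section continuity.
Context {R : realType} {n : nat}.
Implicit Types (f g : 'rV[R]_n -> R).

Lemma continuous_add f g : continuous f -> continuous g ->
  continuous (fun z => f z + g z).
Proof. by move=> cf cg z; exact: (@continuousD _ _ _ f g z (cf z) (cg z)). Qed.

Lemma continuous_mul f g : continuous f -> continuous g ->
  continuous (fun z => f z * g z).
Proof. by move=> cf cg z; exact: (@continuousM _ _ f g z (cf z) (cg z)). Qed.

Lemma continuous_scale (c : R) f : continuous f -> continuous (fun z => c * f z).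
Proof. by apply: continuous_mul; exact: cst_continuous. Qed.

Lemma continuous_sub f g : continuous f -> continuous g ->
  continuous (fun z => f z - g z).
Proof. by move=> cf cg z; exact: (@continuousB _ _ _ f g z (cf z) (cg z)). Qed.

Lemma continuous_ln_comp g : continuous g -> (forall z, 0 < g z) ->
  continuous (fun z => ln (g z)).
Proof.
move=> cg g0 z; apply: (@continuous_comp _ _ _ g (@ln R) z (cg z)).
exact: continuous_ln.
Qed.

Lemma continuous_inv_comp g : continuous g -> (forall z, 0 < g z) ->
  continuous (fun z => (g z)^-1).
Proof.
by move=> cg g0 z; apply: (@continuousV _ _ g z _ (cg z)); rewrite gt_eqF.
Qed.

Lemma continuous_norm g : continuous g -> continuous (fun z => `|g z|).
Proof.
by move=> cg z; apply: continuous_comp; [exact: cg|exact: norm_continuous].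
Qed.

Lemma smooth_dot : smooth (fun z : 'rV[R]_n => dot z z).
Proof. by apply: smooth_sum => i; apply: smoothM; exact: smooth_coord. Qed.

Lemma compact_supportMl f g : compact_support g ->
  compact_support (fun z => f z * g z).
Proof. by move=> [M HM]; exists M => z /HM ->; rewrite mulr0. Qed.

Lemma compact_supportMr f g : compact_support f ->
  compact_support (fun z => f z * g z).
Proof. by move=> [M HM]; exists M => z /HM ->; rewrite mul0r. Qed.

Lemma continuous_compact_support_bounded g : continuous g -> compact_support g ->
  exists2 B : R, 0 <= B & forall z, `|g z| <= B.
Proof.
move=> cg [M HM]; have [B HB] := continuous_bounded_cube (`|M| + 1) cg.
exists `|B| => // z; have [zM|zM] := leP (enorm z) M.
  by rewrite (le_trans (HB _ (bounded_enorm_cube zM)))// ler_norm.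
by rewrite HM// normr0.
Qed.

(** [chi] is twice the positive part of [M - |z|^2]. Continuity is enough for a cutoff because
    admissible directions are only continuous. *)
Lemma continuous_quadratic_bump (M : R) :
  let chi (z : 'rV[R]_n) := (M - dot z z) + `|M - dot z z| in
  [/\ continuous chi, compact_support chi, forall z, 0 <= chi z &
      forall z, dot z z < M -> 0 < chi z].
Proof.
move=> chi; have ct : continuous (fun z : 'rV[R]_n => M - dot z z).
  apply: continuous_sub; first exact: cst_continuous.
  exact/smooth_continuous/smooth_dot.
split.
- apply: continuous_add => //; exact: continuous_norm.
- exists (`|M| + 1) => z Mz; rewrite /chi ler0_norm ?subrr// subr_le0.
  rewrite -sqr_enorm (le_trans (ler_norm _))//.
  have := normr_ge0 M; nra.
- by move=> z; rewrite -lerBlDl sub0r -normrN ler_norm.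
- move=> z; rewrite -subr_gt0 => zM.
  by rewrite /chi gtr0_norm// addr_gt0.
Qed.

End continuity.

(** * Pointwise expansion of the entropy density *)

Section entropy.
Context {R : realType}.

Lemma entropy_expansion (a b : R) : 0 < a -> 0 < a + b ->
  `|(a + b) * ln (a + b) - a * ln a - b * (ln a + 1)| <= b ^+ 2 / a.
Proof.
move=> a0 ab0.
(* divide by [a]: the claim becomes [0 <= (1 + y) ln (1 + y) - y <= y^2] *)
pose y := b / a.
have bE : b = a * y by rewrite /y mulrC divfK// gt_eqF.
have abE : a + b = a * (1 + y) by rewrite bE; ring.
have y0 : 0 < 1 + y by move: ab0; rewrite abE pmulr_rgt0.
have Eln : ln (a + b) = ln a + ln (1 + y) by rewrite abE lnM ?posrE.
have -> : (a + b) * ln (a + b) - a * ln a - b * (ln a + 1) =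
          a * ((1 + y) * ln (1 + y) - y).
  by rewrite Eln bE; ring.
have -> : b ^+ 2 / a = a * y ^+ 2 by rewrite bE; field; rewrite gt_eqF.
(* Both bounds are instances of [ln t <= t - 1]: here with [t = 1 + y], and below with
   [t = (1 + y)^-1]. *)
have up : ln (1 + y) <= y by rewrite le_ln1Dx// -subr_gt0 opprK addrC.
have lo : y <= (1 + y) * ln (1 + y).
  have : ln (1 + ((1 + y)^-1 - 1)) <= (1 + y)^-1 - 1.
    by rewrite le_ln1Dx// ltrBrDl subrr invr_gt0.
  rewrite subrKC lnV ?posrE// lerNl opprB => H.
  rewrite [leLHS](_ : _ = (1 + y) * (1 - (1 + y)^-1)); last by field; rewrite gt_eqF.
  by rewrite ler_wpM2l// ltW.
rewrite normrM gtr0_norm// ler_wpM2l ?(ltW a0)// ger0_norm ?subr_ge0//.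
by nra.
Qed.

End entropy.

(** * Second-order expansions and uniqueness of first variations *)

Section expansions.
Context {R : realType} {d : nat}.
Local Notation mu := (leb (d + d)).
Implicit Types (a f g : 'rV[R]_(d + d) -> R) (D : R -> 'rV[R]_(d + d) -> R).
Implicit Types (e : ('rV[R]_(d + d) -> R) -> 'rV[R]_(d + d) -> R).

(** Reads [D eps = eps a + O(eps^2 b)]. The radius [r] is uniform in [z]: in the entropy it keeps
    the perturbed density positive everywhere. *)
Definition quadratic_expansion D a : Prop := exists b (r : R),
  [/\ 0 < r, mu.-integrable setT (fun z => (a z)%:E),
      mu.-integrable setT (fun z => (b z)%:E),
      forall eps : R, `|eps| < r -> measurable_fun setT (D eps) &
      forall (eps : R) z, `|eps| < r -> `|D eps z - eps * a z| <= eps ^+ 2 * b z].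

(** Lets the free energy be treated as the entropy plus [beta m] times the conservative energy. *)
Lemma quadratic_expansionDZ D1 D2 a1 a2 (c : R) :
  quadratic_expansion D1 a1 -> quadratic_expansion D2 a2 ->
  quadratic_expansion (fun eps z => D1 eps z + c * D2 eps z)
    (fun z => a1 z + c * a2 z).
Proof.
move=> [b1 [r1 [r10 ia1 ib1 m1 H1]]] [b2 [r2 [r20 ia2 ib2 m2 H2]]].
exists (fun z => b1 z + `|c| * b2 z), (Num.min r1 r2); split.
- by rewrite lt_min r10.
- by apply: integrableD_EFin => //; exact: integrableZ_EFin.
- by apply: integrableD_EFin => //; exact: integrableZ_EFin.
- move=> eps; rewrite lt_min => /andP[e1 e2].
  apply: measurable_funD; first exact: m1.
  by apply: measurable_funM => //; exact: m2.
- move=> eps z; rewrite lt_min => /andP[e1 e2].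
  rewrite [X in `|X|](_ : _ = (D1 eps z - eps * a1 z) + c * (D2 eps z - eps * a2 z)); last by ring.
  rewrite [leRHS](_ : _ = eps ^+ 2 * b1 z + `|c| * (eps ^+ 2 * b2 z)); last by ring.
  rewrite (le_trans (ler_normD _ _))// lerD ?H1//.
  by rewrite normrM ler_wpM2l// H2.
Qed.

Lemma quadratic_expansion_derive D a : quadratic_expansion D a ->
  (\forall eps \near (0 : R), mu.-integrable setT (fun z => (D eps z)%:E)) /\
  is_derive (0 : R) (1 : R) (fun eps : R => \int[mu]_z D eps z) (\int[mu]_z a z).
Proof.
move=> [b [r [r0 ia ib mD H]]].
have iD eps : `|eps| < r -> mu.-integrable setT (fun z => (D eps z)%:E).
  move=> er; apply: (@le_integrable_EFin _ _ _ _ _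
      (fun z => `|eps * a z| + eps ^+ 2 * b z)); first exact: mD.
    move=> z; rewrite -[D eps z](subrK (eps * a z)) (le_trans (ler_normD _ _))//.
    by rewrite addrC lerD2l H.
  apply: integrableD_EFin; first exact/integrable_norm_EFin/integrableZ_EFin.
  exact: integrableZ_EFin.
split.
  near=> eps; apply: iD; rewrite -[eps]subr0; near: eps.
  by apply: (filterS _ (nbhsx_ballx (0 : R) r r0)) => eps; rewrite -ball_normE /= distrC.
(* At [eps = 0] the remainder estimate itself forces [D] to vanish. *)
have D0 z : D 0 z = 0.
  have := H 0 z; rewrite normr0 => /(_ r0).
  by rewrite mul0r subr0 expr0n mul0r normr_le0 => /eqP.
apply: (@is_derive_quadratic _ _ _ _ _ _ (\int[mu]_z b z) r) => // h hr.
rewrite add0r [h *: 1]mulr1 Rintegral_increment//; last 2 first.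
- exact: iD.
- by apply: iD; rewrite normr0.
have iE : mu.-integrable setT (fun z => (D h z - D 0 z - h * a z)%:E).
  apply: integrableB_EFin; last exact: integrableZ_EFin.
  by apply: integrableB_EFin; apply: iD => //; rewrite normr0.
apply: le_trans (le_normr_Rintegral measurableT iE) _.
rewrite mulrC -RintegralZl//; apply: le_Rintegral => //.
- exact: integrable_norm_EFin.
- exact: integrableZ_EFin.
- by move=> z _; rewrite D0 subr0 H.
Unshelve. all: by end_near. Qed.

(** Only the integrals of [a] and [g eta] have to agree. This leaves room for the symmetry of the
    convolution and for the zero mass of [eta]. *)
Lemma first_variation_expansion e f g : smooth g ->
  (forall eta : 'rV[R]_(d + d) -> R, admissible eta -> exists2 a,
    quadratic_expansion (fun eps z => e (perturb f eps eta) z - e f z) a &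
    \int[mu]_z a z = \int[mu]_z (g z * eta z)) ->
  first_variation e f g.
Proof.
move=> sg H; split => // eta /H[a qa <-]; exact: quadratic_expansion_derive.
Qed.

Lemma first_variation_unique e f g1 g2 :
  first_variation e f g1 -> first_variation e f g2 ->
  exists c : R, forall z, g1 z = g2 z + c.
Proof.
move=> [s1 v1] [s2 v2]; pose u z := g1 z - g2 z.
have c1 := smooth_continuous s1; have c2 := smooth_continuous s2.
have cu : continuous u by exact: continuous_sub.
(* For fixed [eta], both integrals are the derivative at 0 of the same function of [eps]. *)
have orth (eta : 'rV[R]_(d + d) -> R) : admissible eta -> \int[mu]_z (u z * eta z) = 0.
  move=> ae; have [_ [_ E1]] := v1 _ ae; have [_ [_ E2]] := v2 _ ae.
  have [ceta seta _] := ae.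
  have i g : continuous g -> mu.-integrable setT (fun z => (g z * eta z)%:E).
    move=> cg; apply: integrable_compact_support; first exact: continuous_mul.
    exact: compact_supportMl.
  transitivity (\int[mu]_z (g1 z * eta z) - \int[mu]_z (g2 z * eta z)).
    rewrite -RintegralB//; [|exact: i|exact: i].
    by apply: eq_Rintegral => z _; rewrite -mulrBl.
  by rewrite -E1 E2 subrr.
suff cst z : u z = u 0 by exists (u 0) => z; rewrite -(cst z) /u subrKC.
(* The level [|z|^2 + 1] makes the cutoff positive both at [z] and at the origin, the two points to
   be compared. *)
have [cchi schi chi0 chigt] := @continuous_quadratic_bump R (d + d) (dot z z + 1).
set chi := (fun z' : 'rV[R]_(d + d) => _) in cchi schi chi0 chigt.
have i g : continuous g -> mu.-integrable setT (fun z => (g z * chi z)%:E).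
  move=> cg; apply: integrable_compact_support; first exact: continuous_mul.
  exact: compact_supportMl.
have ichi : mu.-integrable setT (fun z => (chi z)%:E).
  exact: integrable_compact_support.
have d0 : dot (0 : 'rV[R]_(d + d)) 0 = 0.
  by rewrite /dot big1// => j _; rewrite !mxE mulr0.
have chi00 : 0 < chi 0 by apply: chigt; rewrite d0 addrC dot1_gt0.
have Ichi : \int[mu]_z chi z != 0.
  apply/eqP => /(continuous_Rintegral0_eq0 cchi chi0 ichi)/(_ 0) E.
  by rewrite E ltxx in chi00.
(* The [chi]-average of [u], which gives [eta] zero mass and so makes it admissible. *)
pose c := (\int[mu]_z (u z * chi z)) / \int[mu]_z chi z.
pose eta z := (u z - c) * chi z.
have cuc : continuous (fun z => u z - c).
  by apply: continuous_sub => //; exact: cst_continuous.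
have ceta : continuous eta by exact: continuous_mul.
have ieta : \int[mu]_z eta z = 0.
  transitivity (\int[mu]_z (u z * chi z) - \int[mu]_z (c * chi z)).
    rewrite -RintegralB//; [|exact: i|exact: integrableZ_EFin].
    by apply: eq_Rintegral => z' _; rewrite -mulrBl.
  by rewrite RintegralZl// /c divfK// subrr.
have aeta : admissible eta by split => //; exact: compact_supportMl.
have sq : \int[mu]_z ((u z - c) ^+ 2 * chi z) = 0.
  transitivity (\int[mu]_z (u z * eta z) - \int[mu]_z (c * eta z)).
    rewrite -RintegralB//.
    - by apply: eq_Rintegral => z' _; rewrite /eta; ring.
    - apply: integrable_compact_support; first exact: continuous_mul.
      by apply: compact_supportMl; exact: compact_supportMl.
    - apply: integrable_compact_support; first exact: continuous_scale.
      by apply: compact_supportMl; exact: compact_supportMl.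
  rewrite orth// RintegralZl ?ieta ?mulr0 ?subrr//.
  by apply: integrable_compact_support => //; exact: compact_supportMl.
have csq : continuous (fun z => (u z - c) ^+ 2).
  by under eq_fun do rewrite expr2; exact: continuous_mul.
have cz z' : 0 < chi z' -> u z' = c.
  move=> chi_gt; apply/eqP; rewrite -subr_eq0 -sqrf_eq0.
  have := @continuous_Rintegral0_eq0 R (d + d) (fun z => (u z - c) ^+ 2 * chi z)
    (continuous_mul csq cchi) (fun z => mulr_ge0 (sqr_ge0 _) (chi0 z)) (i _ csq) sq z'.
  by move/eqP; rewrite mulf_eq0 (gt_eqF chi_gt) orbF.
by rewrite !cz// chigt// ltrDl.
Qed.

End expansions.

(** * First variations of the conservative and free energies *)

Section energy_variations.
Context {R : realType} {d : nat}.
Local Notation mu := (leb (d + d)).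
Variables (m : R) (U K : 'rV[R]_d -> R) (f : 'rV[R]_(d + d) -> R).
Hypotheses (m0 : m != 0) (sU : smooth U) (sK : smooth K).
Hypotheses (gK : forall s, quadratic_growth (pds s K)).
Hypothesis eK : forall x, K (- x) = K x.
Hypotheses (sf : smooth f) (f0 : forall z, 0 < f z) (mf : second_moment f).

Let cK : continuous K. Proof. exact: smooth_continuous. Qed.
Let gK0 : quadratic_growth K := gK [::].

Lemma smooth_hamiltonian : smooth (hamiltonian m U K f).
Proof.
apply: smoothD; first apply: smoothD.
- exact: smooth_kinetic.
- by apply: smoothZ; exact: smooth_comp_pos.
- by apply: smoothZ; apply: smooth_comp_pos; exact: smooth_conv.
Qed.

Lemma smooth_hamiltonian_check : smooth (hamiltonian_check m U K f).
Proof.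
apply: smoothD; first apply: smoothD.
- exact: smooth_kinetic.
- by apply: smoothZ; exact: smooth_comp_pos.
- by apply: smoothZ; apply: smooth_comp_pos; exact: smooth_conv.
Qed.

Lemma second_moment_compact_support (eta : 'rV[R]_(d + d) -> R) : continuous eta ->
  compact_support eta -> second_moment eta.
Proof.
move=> ceta seta; split; first exact: continuous_measurable_rV.
apply: integrable_compact_support; last exact: compact_supportMl.
apply: continuous_mul => //; apply: continuous_add; first exact: cst_continuous.
exact/smooth_continuous/smooth_dot.
Qed.

Lemma conv_pos_growth (w : 'rV[R]_(d + d) -> R) : second_moment w ->
  measurable_fun setT (fun z : 'rV[R]_(d + d) => conv K w (pos z)) /\
  quadratic_growth (fun z : 'rV[R]_(d + d) => conv K w (pos z)).
Proof.
move=> mw; split.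
  apply: continuous_measurable_rV; apply: smooth_continuous.
  exact: (smooth_comp_pos (smooth_conv sK gK mw)).
have [C C0 HC] := conv_growth cK gK0 mw; exists C => // z.
apply: le_trans (HC _) _; rewrite ler_wpM2l// lerD2l.
exact: ler_dot_pos.
Qed.

Lemma conservative_energy_expansion eta : admissible eta ->
  exists2 a, quadratic_expansion (fun eps z =>
      H_integrand m U K (perturb f eps eta) z - H_integrand m U K f z) a &
    \int[mu]_z a z = \int[mu]_z (hamiltonian m U K f z * eta z).
Proof.
move=> [ceta seta _]; have meta := second_moment_compact_support ceta seta.
have [mKe gKe] := conv_pos_growth meta; have [mKf gKf] := conv_pos_growth mf.
pose c := (2 * m)^-1.
have cconv (w : 'rV[R]_(d + d) -> R) : second_moment w -> continuous (fun z : 'rV[R]_(d + d) => conv K w (pos z)).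
  by move=> mw; apply: smooth_continuous; exact: (smooth_comp_pos (smooth_conv sK gK mw)).
have cp := smooth_continuous smooth_hamiltonian_check.
have ip : mu.-integrable setT (fun z => (hamiltonian_check m U K f z * eta z)%:E).
  apply: integrable_compact_support; first exact: continuous_mul.
  exact: compact_supportMl.
have ife : mu.-integrable setT (fun z => (f z * conv K eta (pos z))%:E).
  apply: eq_integrable_EFin (integrable_second_moment mKe gKe mf) => z.
  exact: mulrC.
have ief : mu.-integrable setT (fun z => (eta z * conv K f (pos z))%:E).
  apply: eq_integrable_EFin (integrable_second_moment mKf gKf meta) => z.
  exact: mulrC.
have iee : mu.-integrable setT (fun z => (eta z * conv K eta (pos z))%:E).
  apply: eq_integrable_EFin (integrable_second_moment mKe gKe meta) => z.
  exact: mulrC.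
(* The linear part of a quadratic functional: [eta] replaces the outer [f] in one term and the [f]
   inside the convolution in the other. *)
pose a z := hamiltonian_check m U K f z * eta z + c * (f z * conv K eta (pos z)).
have ia : mu.-integrable setT (fun z => (a z)%:E).
  by apply: integrableD_EFin => //; exact: integrableZ_EFin.
have DE eps z : H_integrand m U K (perturb f eps eta) z - H_integrand m U K f z =
    eps * a z + eps ^+ 2 * (c * (eta z * conv K eta (pos z))).
  rewrite /H_integrand /hamiltonian_check conv_perturb// -/c /a /hamiltonian_check -/c.
  by rewrite /perturb; ring.
exists a.
  (* The expansion is exact, with [eta (K * eta)] as its only second-order term, so any radius would
     do. *)
  exists (fun z => `|c * (eta z * conv K eta (pos z))|), 1; split => //.
  - exact/integrable_norm_EFin/integrableZ_EFin.
  - move=> eps _; under eq_fun do rewrite DE.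
    apply: measurable_funD.
      by apply: measurable_funM => //; exact: integrable_measurable_EFin ia.
    apply: measurable_funM => //; apply: measurable_funM => //.
    exact: integrable_measurable_EFin iee.
  - move=> eps z _; rewrite DE addrAC subrr add0r normrM.
    by rewrite ger0_norm ?sqr_ge0.
rewrite RintegralD//; last exact: integrableZ_EFin.
(* Symmetry turns [f (K * eta)] into [eta (K * f)], and the two halves [1 / (2 m)] add up to the
   [1 / m] of [hamiltonian]. *)
rewrite RintegralZl// conv_sym// -RintegralZl// -RintegralD//; last exact: integrableZ_EFin.
apply: eq_Rintegral => z _; rewrite /hamiltonian /hamiltonian_check /c.
by field.
Qed.

Lemma entropy_variation_expansion eta : admissible eta ->
  quadratic_expansion (fun eps z =>
    perturb f eps eta z * ln (perturb f eps eta z) - f z * ln (f z))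
    (fun z => eta z * (ln (f z) + 1)).
Proof.
move=> [ceta seta _]; have cf := smooth_continuous sf.
have cif : continuous (fun z => (f z)^-1) by exact: continuous_inv_comp.
(* [eta / f] is continuous with compact support, hence bounded, although [f] may tend to 0 at
   infinity. So [1 + eps eta / f] stays positive for [|eps| < 1 / (B + 1)]. *)
have [B B0 HB] : exists2 B : R, 0 <= B & forall z, `|(f z)^-1 * eta z| <= B.
  apply: continuous_compact_support_bounded; first exact: continuous_mul.
  exact: compact_supportMl.
have pos_eps eps z : `|eps| < (B + 1)^-1 -> 0 < f z + eps * eta z.
  move=> epsB; rewrite [ltRHS](_ : _ = f z * (1 + eps * ((f z)^-1 * eta z))).
    rewrite mulr_gt0// -ltrBlDl sub0r ltrNl (le_lt_trans (ler_norm _))// normrN normrM.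
    have B1 : 0 < B + 1 by rewrite ltr_wpDl.
    apply: (@le_lt_trans _ _ (`|eps| * (B + 1))).
      by rewrite ler_wpM2l// (le_trans (HB z))// lerDl.
    by rewrite -ltr_pdivlMr// mul1r.
  by field; rewrite gt_eqF.
exists (fun z => eta z ^+ 2 / f z), (B + 1)^-1; split.
- by rewrite invr_gt0 ltr_wpDl.
- apply: integrable_compact_support; last exact: compact_supportMr.
  apply: continuous_mul => //; apply: continuous_add; last exact: cst_continuous.
  exact: continuous_ln_comp.
- apply: integrable_compact_support.
    apply: continuous_mul => //.
    by under eq_fun do rewrite expr2; exact: continuous_mul.
  apply: compact_supportMr; have [M HM] := seta.
  by exists M => z /HM ->; rewrite expr0n.
- move=> eps epsB; apply: continuous_measurable_rV.
  have cfe : continuous (perturb f eps eta).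
    by apply: continuous_add => //; exact: continuous_scale.
  apply: continuous_sub; apply: continuous_mul => //; apply: continuous_ln_comp => //.
  by move=> z; exact: pos_eps.
- move=> eps z epsB; have := @entropy_expansion R (f z) (eps * eta z) (f0 z) (pos_eps eps z epsB).
  by rewrite /perturb exprMn -!mulrA.
Qed.

Lemma first_variation_conservative_energy :
  first_variation (H_integrand m U K) f (hamiltonian m U K f).
Proof.
apply: first_variation_expansion; first exact: smooth_hamiltonian.
exact: conservative_energy_expansion.
Qed.

Lemma smooth_free_energy_variation (beta : R) :
  smooth (fun z => ln (f z) + beta * m * hamiltonian m U K f z).
Proof.
apply: smoothD; first exact: smooth_ln.
by apply: smoothZ; exact: smooth_hamiltonian.
Qed.

Lemma first_variation_free_energy (beta : R) :
  first_variation (F_integrand m beta U K) f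
    (fun z => ln (f z) + beta * m * hamiltonian m U K f z).
Proof.
apply: first_variation_expansion; first exact: smooth_free_energy_variation.
move=> eta aeta; have qe := entropy_variation_expansion aeta.
have [a qa Ea] := conservative_energy_expansion aeta.
exists (fun z => eta z * (ln (f z) + 1) + beta * m * a z).
  have := quadratic_expansionDZ (beta * m) qe qa.
  congr quadratic_expansion; apply/funext => eps; apply/funext => z.
  by rewrite /F_integrand /H_integrand; ring.
have [ceta seta ieta] := aeta; have cf := smooth_continuous sf.
have cln : continuous (fun z => ln (f z)) by exact: continuous_ln_comp.
have [_ [_ [_ ie _ _ _]]] := qe; have [_ [_ [_ ia _ _ _]]] := qa.
have ih : mu.-integrable setT (fun z => (hamiltonian m U K f z * eta z)%:E).
  apply: integrable_compact_support; last exact: compact_supportMl.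
  by apply: continuous_mul => //; exact/smooth_continuous/smooth_hamiltonian.
have il : mu.-integrable setT (fun z => (ln (f z) * eta z)%:E).
  apply: integrable_compact_support; last exact: compact_supportMl.
  exact: continuous_mul.
have iet : mu.-integrable setT (fun z => (eta z)%:E).
  exact: integrable_compact_support.
rewrite RintegralD//; last exact: integrableZ_EFin.
rewrite RintegralZl// Ea.
(* The constant 1 in the derivative of [t ln t] disappears because [eta] has zero mass. *)
have -> : \int[mu]_z (eta z * (ln (f z) + 1)) = \int[mu]_z (ln (f z) * eta z).
  transitivity (\int[mu]_z (ln (f z) * eta z) + \int[mu]_z eta z).
    by rewrite -RintegralD//; apply: eq_Rintegral => z _; ring.
  by rewrite ieta addr0.
rewrite -RintegralZl// -RintegralD//; last exact: integrableZ_EFin.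
by apply: eq_Rintegral => z _; ring.
Qed.

End energy_variations.

(** * Second moments of the density *)

Section law_moment.
Context {R : realType} {d : nat} {dO : measure_display}
  {Omega : measurableType dO} (P : probability Omega R).
Local Notation mu := (leb (d + d)).

(** The integral of [(1 + |z|^2) f] is transferred to the law by the density and then to the
    probability space by push-forward, where it is [1 + E(|x|^2 + |v|^2)]. *)
Lemma second_moment_density (x v : Omega -> 'rV[R]_d) (f : 'rV[R]_(d + d) -> R)
    (C : R) :
  measurable_fun setT x -> measurable_fun setT v ->
  (\int[P]_w (enorm (x w) ^+ 2 + enorm (v w) ^+ 2)%R%:E <= C%:E)%E ->
  has_density (pushforward P (fun w => row_mx (x w) (v w))) f ->
  second_moment f.
Proof.
move=> mx mv xvC [mf f0 fE]; split => //.
pose Z w : 'rV[R]_(d + d) := row_mx (x w) (v w).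
have mZ : measurable_fun setT Z.
  apply: measurable_fun_rVP => i; case: (split_ordP i) => j ->.
    by under eq_fun do rewrite row_mxEl;
      exact: (measurableT_comp (measurable_rV_coord j) mx).
  by under eq_fun do rewrite row_mxEr;
    exact: (measurableT_comp (measurable_rV_coord j) mv).
have mg : measurable_fun setT (fun z : 'rV[R]_(d + d) => 1 + dot z z).
  apply: continuous_measurable_rV; apply: continuous_add.
    exact: cst_continuous.
  by apply: smooth_continuous; exact: smooth_dot.
apply/integrableP; split; first exact/measurable_EFinP/measurable_funM.
under eq_integral do rewrite gee0_abs ?lee_fin ?mulr_ge0 ?(ltW (dot1_gt0 _))// EFinM.
rewrite -(@ge0_integral_density _ _ _ mu (pushforward P Z) f mf f0 fE)//; last 2 first.
- exact/measurable_EFinP.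
- by move=> z; rewrite lee_fin ltW// dot1_gt0.
rewrite ge0_integral_pushforward//; last 2 first.
- exact/measurable_EFinP.
- by move=> z _; rewrite lee_fin ltW// dot1_gt0.
rewrite preimage_setT /=.
have E w : ((1 + dot (Z w) (Z w))%:E =
    (1%:E + (enorm (x w) ^+ 2 + enorm (v w) ^+ 2)%:E))%E.
  by rewrite dot_pos_vel /pos /vel row_mxKl row_mxKr !sqr_enorm EFinD.
under eq_integral do rewrite E.
rewrite ge0_integralD//; last 2 first.
- by move=> w _; rewrite lee_fin addr_ge0// sqr_ge0.
- apply/measurable_EFinP.
  (* Measurability of the sum of squared norms is inherited from [1 + |Z|^2], with which it agrees
     up to the constant by [E]. *)
  have : measurable_fun setT (fun w => (1 + dot (Z w) (Z w)) - 1).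
    by apply: measurable_funB => //; exact: (measurableT_comp mg mZ).
  congr measurable_fun; apply/funext => w; apply: EFin_inj.
  by rewrite EFinB E addeAC subee// add0e.
rewrite integral_cst// mul1e [X in (X + _)%E](_ : _ = 1%E); last exact: probability_setT.
by rewrite (le_lt_trans (leeD2l _ xvC))// -EFinD ltry.
Qed.

End law_moment.

(** * The GENERIC equation *)

Section gradients.
Context {R : realType}.

(** The constant cancels in every difference quotient, so the limits coincide even where [g] is not
    differentiable. *)
Lemma pdDcst n i (g : 'rV[R]_n -> R) (c : R) : pd i (fun z => g z + c) = pd i g.
Proof.
apply/funext => z; apply: (congr1 (fun F : R -> R => lim (F @ 0^'))).
by apply/funext => h /=; rewrite opprD addrACA subrr addr0.
Qed.

Lemma gradDcst n (g : 'rV[R]_n -> R) (c : R) : grad (fun z => g z + c) = grad g.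
Proof. by apply/funext => z; apply/rowP => i; rewrite !mxE pdDcst. Qed.

Lemma is_derive_pd n i (g : 'rV[R]_n -> R) z l :
  is_derive z (delta_mx ord0 i) g l -> pd i g z = l.
Proof. by case. Qed.

Lemma gradx_coord d (g : 'rV[R]_(d + d) -> R) z i :
  gradx g z ord0 i = pd (lshift d i) g z.
Proof. by rewrite !mxE. Qed.

Lemma gradv_coord d (g : 'rV[R]_(d + d) -> R) z i :
  gradv g z ord0 i = pd (rshift d i) g z.
Proof. by rewrite !mxE. Qed.

End gradients.

(** * The operators evaluated on the first variations *)

Section generic_form.
Context {R : realType} {d : nat}.
Variables (m gamma beta : R) (U K : 'rV[R]_d -> R) (f : 'rV[R]_(d + d) -> R).
Hypotheses (m0 : 0 < m) (gamma0 : 0 < gamma) (beta0 : 0 < beta).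
Hypotheses (sU : smooth U) (sf : smooth f) (f0 : forall z, 0 < f z).
Hypothesis sconv : smooth (conv K f).

Lemma gradx_hamiltonian z : gradx (hamiltonian m U K f) z =
  m^-1 *: grad (fun x => U x + conv K f x) (pos z).
Proof.
apply/rowP => i; rewrite gradx_coord !mxE.
have dU := derivableP (smooth_derivable sU (i := i) (x := pos z)).
have dC := derivableP (smooth_derivable sconv (i := i) (x := pos z)).
have D1 := is_derive_kinetic_pos z i.
have D2 := is_deriveZ m^-1 (is_derive_pos dU).
have D3 := is_deriveZ m^-1 (is_derive_pos dC).
have D := is_deriveD (is_deriveD D1 D2) D3.
rewrite (is_derive_pd D) add0r -scalerDr; congr (_ * _).
by rewrite (is_derive_pd (is_deriveD dU dC)).
Qed.

Lemma gradv_hamiltonian z : gradv (hamiltonian m U K f) z = vel z.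
Proof.
apply/rowP => i; rewrite gradv_coord.
have D1 := is_derive_kinetic_vel z i.
have D2 := is_deriveZ m^-1 (is_derive_pos_vel U z i).
have D3 := is_deriveZ m^-1 (is_derive_pos_vel (conv K f) z i).
by rewrite (is_derive_pd (is_deriveD (is_deriveD D1 D2) D3)) !scaler0 !addr0.
Qed.

Lemma sqr_sigma : sigma m gamma beta ^+ 2 = 2 * gamma / (beta * m ^+ 2).
Proof.
by rewrite sqr_sqrtr// ltW// divr_gt0// mulr_gt0// exprn_gt0.
Qed.

Lemma diffusion_flux_pos psi z i :
  diffusion_flux m gamma beta f psi z ord0 (lshift d i) = 0.
Proof.
rewrite /diffusion_flux /Gmx tr_col_mx mul_col_row !mul0mx trmx0 mulmx0.
rewrite linearZ /= tr_block_mx -scalemxAr mxE [X in _ * X](_ : _ = 0) ?mulr0//.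
rewrite mxE big1// => j _.
case: (split_ordP j) => k ->; rewrite ?block_mxEul ?block_mxEdl !mxE ?mulr0//.
Qed.

Lemma diffusion_flux_vel psi z i :
  diffusion_flux m gamma beta f psi z ord0 (rshift d i) =
  sigma m gamma beta ^+ 2 / 2 * (f z * pd (rshift d i) psi z).
Proof.
rewrite /diffusion_flux /Gmx tr_col_mx mul_col_row !mul0mx trmx0 mulmx0.
rewrite linearZ /= tr_block_mx -scalemxAr mxE tr_scalar_mx -scalar_mxM tr_scalar_mx.
rewrite mxE big_split_ord /= big1 ?add0r; last first.
  by move=> k _; rewrite block_mxEur !mxE mulr0.
rewrite (bigD1 i)//= big1 ?addr0; last first.
  by move=> k ki; rewrite block_mxEdr !mxE (negbTE ki) mulr0n mulr0.
by rewrite block_mxEdr !mxE eqxx mulr1n; ring.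
Qed.

(** The flux has only velocity components because [G G^T] is block diagonal with blocks 0 and
    [sigma^2 I]. There the factor [f] cancels the denominator of the gradient of [ln f], leaving
    [(gamma / m) f v] plus [sigma^2 / 2] times the velocity gradient of [f]. *)
Lemma div_free_energy_flux z :
  div (diffusion_flux m gamma beta f
         (fun z => ln (f z) + beta * m * hamiltonian m U K f z)) z =
  gamma / m * divv (fun y => f y *: vel y) z
  + sigma m gamma beta ^+ 2 / 2 * laplacev f z.
Proof.
have dpf i y : derivable (pd i f) y (delta_mx ord0 i).
  by apply: smooth_derivable; exact: smooth_pd.
have dfv i y : derivable (fun y : 'rV[R]_(d + d) => f y * vel y ord0 i) y
    (delta_mx ord0 (rshift d i)).
  under eq_fun do rewrite vel_coord.
  by apply: smooth_derivable; apply: smoothM => //; exact: smooth_coord.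
rewrite /div big_split_ord /= big1 ?add0r; last first.
  move=> i _; rewrite (_ : (fun y => _) = cst 0) ?/pd ?derive_cst//.
  by apply/funext => y; rewrite diffusion_flux_pos.
rewrite /laplacev /divv !mulr_sumr -big_split /=; apply: eq_bigr => i _.
pose s := sigma m gamma beta ^+ 2 / 2.
have -> : (fun y => diffusion_flux m gamma beta f
    (fun z => ln (f z) + beta * m * hamiltonian m U K f z) y ord0 (rshift d i)) =
  (gamma / m \*: (fun y : 'rV[R]_(d + d) => (f y * vel y ord0 i))) +
  (s \*: pd (rshift d i) f).
  apply/funext => y; rewrite diffusion_flux_vel.
  have dl := is_derive_ln_comp (f0 y) (smooth_derivable sf (i := rshift d i) (x := y)).
  have D1 := is_derive_kinetic_vel y i.
  have D2 := is_deriveZ m^-1 (is_derive_pos_vel U y i).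
  have D3 := is_deriveZ m^-1 (is_derive_pos_vel (conv K f) y i).
  have D := is_deriveD dl (is_deriveZ (beta * m) (is_deriveD (is_deriveD D1 D2) D3)).
  rewrite (is_derive_pd D) !scaler0 !addr0 /s sqr_sigma.
  rewrite -[RHS]/(gamma / m * (f y * vel y ord0 i)
    + 2 * gamma / (beta * m ^+ 2) / 2 * pd (rshift d i) f y).
  rewrite -/(pd (rshift d i) f y) -[_ *: _]/(_ * _).
  by field; rewrite !gt_eqF.
have D1 := is_deriveZ (gamma / m) (derivableP (dfv i z)).
have D2 := is_deriveZ s (derivableP (dpf (rshift d i) z)).
rewrite (is_derive_pd (is_deriveD D1 D2)); congr (_ * _ + _ * _).
  by congr pd; apply/funext => y; rewrite !mxE.
by congr pd; apply/funext => y; rewrite gradv_coord.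
Qed.

End generic_form.

Theorem mainTheorem3 (R : realType) (d : nat) (hd : (0 < d)%N)
  (T m gamma beta : R)
  (hT : 0 < T) (hm : 0 < m) (hgamma : 0 < gamma) (hbeta : 0 < beta)
  (U K : 'rV[R]_d -> R) (hUK : regular_potentials U K)
  (dO : measure_display) (Omega : measurableType dO) (P : probability Omega R)
  (FF : R -> set (set Omega)) (hFF : normal_filtration P FF)
  (B : R -> Omega -> 'rV[R]_d) (hB : brownian_motion P FF B)
  (X V : R -> Omega -> 'rV[R]_d)
  (hXV : langevin_solution P m gamma beta T U K FF B X V)
  (f : R -> 'rV[R]_(d + d) -> R)
  (hf0 : regular_initial P m beta U K (f 0) X V)
  (hf : density_flow P m gamma beta T U K X V f) :
  forall t : R, 0 < t < T ->
    let h := hamiltonian m U K (f t) in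
    let psi_F := fun z => ln (f t z) + beta * m * h z in
    [/\ first_variation (H_integrand m U K) (f t) h,
        first_variation (F_integrand m beta U K) (f t) psi_F &
        forall phi psi : 'rV[R]_(d + d) -> R,
          first_variation (H_integrand m U K) (f t) phi ->
          first_variation (F_integrand m beta U K) (f t) psi ->
          forall z : 'rV[R]_(d + d),
            derive1 (f ^~ z) t =
              poisson_op (f t) phi z - onsager_op m gamma beta (f t) psi z /\
            poisson_op (f t) phi z - onsager_op m gamma beta (f t) psi z =
              - poisson (f t) h z
              + div (diffusion_flux m gamma beta (f t) psi_F) z].
Proof.
move=> t t0T h psi_F; have [t0 tT] := andP t0T.
have t0T' : 0 <= t <= T by rewrite !ltW.
have sf : smooth (f t) by exact: df_smooth hf _ t0T'.
have f0 : forall z, 0 < f t z by apply: (df_pos hf); rewrite t0 ltW.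
have sU := rp_smoothU hUK; have sK := rp_smoothK hUK; have eK := rp_symK hUK.
have gK : forall s, quadratic_growth (pds s K).
  apply: smooth_lipschitz_quadratic_growth => //; first exact: rp_lipK hUK.
  move=> j j2; have [C HC] := rp_bounded hUK j2.
  by exists C => x; have [] := HC x.
(* Random variables adapted at time [t] are measurable, as the filtration consists of measurable
   sets. *)
have measurable_adapted (Y : Omega -> 'rV[R]_d) :
    measurable_wrt (FF t) Y -> measurable_fun setT Y.
  by move=> mY _ A mA; rewrite setTI; apply: (nf_sub hFF (ltW t0)); exact: mY.
(* The moment bound of the solution is what makes [K * f t] well defined and smooth. *)
have mf : second_moment (f t).
  have [mX mV] := ls_adapted hXV t0T'; have [C HC] := ls_moment hXV.
  exact: (second_moment_density (measurable_adapted _ mX)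
    (measurable_adapted _ mV) (HC _ t0T') (df_density hf t0T')).
have sconv := smooth_conv sK gK mf.
have fvH := first_variation_conservative_energy (lt0r_neq0 hm) sU sK gK eK mf.
have fvF := first_variation_free_energy (lt0r_neq0 hm) sU sK gK eK sf f0 mf beta.
split => // phi psi fphi fpsi z.
have [c1 Hphi] := first_variation_unique fphi fvH.
have [c2 Hpsi] := first_variation_unique fpsi fvF.
(* Arbitrary first variations differ from the explicit ones by constants, which the gradients in
   both operators do not see. *)
have gphi : grad phi = grad h by rewrite (funext Hphi) gradDcst.
have gpsi : grad psi = grad psi_F by rewrite (funext Hpsi) gradDcst.
have Epoisson : poisson_op (f t) phi z = - poisson (f t) h z.
  by rewrite /poisson_op /poisson /gradx /gradv gphi.
have Eflux : diffusion_flux m gamma beta (f t) psi =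
    diffusion_flux m gamma beta (f t) psi_F.
  by apply/funext => y; rewrite /diffusion_flux gpsi.
rewrite Epoisson /onsager_op opprK Eflux; split => //.
(* Friction and diffusion are traded for the time derivative plus the transport terms of the
   Vlasov-Fokker-Planck equation; the latter cancel against the Poisson bracket. *)
rewrite div_free_energy_flux// -(df_vfp hf t0T z).
rewrite /poisson gradv_hamiltonian// gradx_hamiltonian//.
have -> : dot (gradx (f t) z) (vel z) = dot (vel z) (gradx (f t) z).
  by apply: eq_bigr => i _; rewrite mulrC.
have dotZr (x y : 'rV[R]_d) c : dot x (c *: y) = c * dot y x.
  by rewrite /dot mulr_sumr; apply: eq_bigr => i _; rewrite mxE; ring.
by rewrite dotZr; ring.
Qed.
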